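(* The algebra $\mathcal{D}$ of doubly symmetric functions is generated (as an algebra) by the power sums $\{p_n \mid n \text{ is odd}\}$ and has basis $\{p_\lambda \mid \lambda \text{ is odd}\}$. Moreover, $\mathcal{D}$ is spanned by $\{DS_\lambda\}$ ($\lambda$ ranging over all partitions) and generated (as an algebra) by $\{k_n\}_{n\ge1}$.
   Context: $\mathcal{S}$ is the algebra of symmetric functions over $\mathbb{Q}$, with basis the Schur functions $S_\lambda$ indexed by all partitions $\lambda$ (including the empty one). For $n\ge1$, $p_n=\sum_i x_i^n$, and $p_\lambda=p_{\lambda_1}\cdots p_{\lambda_m}$ for a partition $\lambda=(\lambda_1,\ldots,\lambda_m)$ with positive parts (with $p_\emptyset=1$). A partition is odd if every one of its parts is odd (so the empty partition is odd). $DS_\lambda=\sum_{\mu\subseteq\lambda}S_\mu S_{(\lambda/\mu)'}$, where $S_{(\lambda/\mu)'}$ is the skew Schur function of the conjugate skew shape $(\lambda/\mu)'=\lambda'/\mu'$. For $n\ge1$, $k_n=\sum_{a+b=n,\ a\ge1,\ b\ge0}S_{(a,1^b)}$. Hook Schur functions: for finite, possibly empty, lists of variables $X=(x_1,\ldots,x_k)$, $Y=(y_1,\ldots,y_\ell)$, a $(k,\ell)$-semistandard tableau of shape $\lambda$ is a filling of the Young diagram of $\lambda$ with entries from the ordered alphabet $1<2<\cdots<k<1'<\cdots<\ell'$ such that entries are non-decreasing in each row and each column, unprimed symbols may repeat in rows but not in columns, and primed symbols may repeat in columns but not in rows. Then $HS_\lambda(X;Y)=\sum_T x^T$, summed over all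 such tableaux $T$, where $x^T=\prod_j x_j^{\#\{j \text{ in } T\}}\prod_j y_j^{\#\{j'\text{ in }T\}}$. A symmetric function $\sum_\lambda m_\lambda S_\lambda$ is doubly symmetric if for all finite (possibly empty) sets of variables $X,Y$ one has $\sum_\lambda m_\lambda S_\lambda(X,Y)=\sum_\lambda m_\lambda HS_\lambda(X;Y)$, where $S_\lambda(X,Y)$ is the Schur polynomial in all the variables of $X$ and $Y$ together. $\mathcal{D}\subseteq\mathcal{S}$ is the set of all doubly symmetric functions. *)

(* Defs.v *)
From HB Require Import structures.
From mathcomp Require Import all_boot all_order all_algebra.
From mathcomp Require Import boolp.
From mathcomp Require Import mpoly.

Set Implicit Arguments.
Unset Strict Implicit.
Unset Printing Implicit Defensive.

Import GRing.Theory.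
Local Open Scope ring_scope.

(* Symmetric functions are taken in the sense of the inverse limit of the rings
   of symmetric polynomials: f n is the specialisation of f to the variables
   x_1, ..., x_n (indexed by 'I_n), i.e. with x_i = 0 for i > n.  The ambient
   algebra consists of all families, with pointwise operations. *)
Definition polyfam : Type := forall n : nat, {mpoly rat[n]}.

Section PolyfamAlgebra.
Implicit Types (f g h : polyfam) (a b : rat).

HB.instance Definition _ := gen_eqMixin polyfam.
HB.instance Definition _ := gen_choiceMixin polyfam.

Lemma polyfamP f g : (forall n, f n = g n) -> f = g.
Proof. exact: functional_extensionality_dep. Qed.

Definition polyfam_zero : polyfam := fun=> 0.
Definition polyfam_one : polyfam := fun=> 1.
Definition polyfam_opp f : polyfam := fun n => - f n.
Definition polyfam_add f g : polyfam := fun n => f n + g n.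
Definition polyfam_mul f g : polyfam := fun n => f n * g n.
Definition polyfam_scale a f : polyfam := fun n => a *: f n.

Fact polyfam_addA : associative polyfam_add.
Proof. by move=> f g h; apply: polyfamP => n; exact: addrA. Qed.
Fact polyfam_addC : commutative polyfam_add.
Proof. by move=> f g; apply: polyfamP => n; exact: addrC. Qed.
Fact polyfam_add0 : left_id polyfam_zero polyfam_add.
Proof. by move=> f; apply: polyfamP => n; exact: add0r. Qed.
Fact polyfam_addN : left_inverse polyfam_zero polyfam_opp polyfam_add.
Proof. by move=> f; apply: polyfamP => n; exact: addNr. Qed.
HB.instance Definition _ := GRing.isZmodule.Build polyfam
  polyfam_addA polyfam_addC polyfam_add0 polyfam_addN.

Fact polyfam_mulA : associative polyfam_mul.
Proof. by move=> f g h; apply: polyfamP => n; exact: mulrA. Qed.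
Fact polyfam_mulC : commutative polyfam_mul.
Proof. by move=> f g; apply: polyfamP => n; exact: mulrC. Qed.
Fact polyfam_mul1 : left_id polyfam_one polyfam_mul.
Proof. by move=> f; apply: polyfamP => n; exact: mul1r. Qed.
Fact polyfam_mulDl : left_distributive polyfam_mul +%R.
Proof. by move=> f g h; apply: polyfamP => n; exact: mulrDl. Qed.
Fact polyfam_one_neq0 : polyfam_one != 0.
Proof.
by apply/eqP => /(congr1 (fun f : polyfam => f 0%N)) /eqP; rewrite oner_eq0.
Qed.
HB.instance Definition _ := GRing.Zmodule_isComNzRing.Build polyfam
  polyfam_mulA polyfam_mulC polyfam_mul1 polyfam_mulDl polyfam_one_neq0.

Fact polyfam_scaleA a b f :
  polyfam_scale a (polyfam_scale b f) = polyfam_scale (a * b) f.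
Proof. by apply: polyfamP => n; exact: scalerA. Qed.
Fact polyfam_scale1 : left_id 1 polyfam_scale.
Proof. by move=> f; apply: polyfamP => n; exact: scale1r. Qed.
Fact polyfam_scaleDr : right_distributive polyfam_scale +%R.
Proof. by move=> a f g; apply: polyfamP => n; exact: scalerDr. Qed.
Fact polyfam_scaleDl f : {morph polyfam_scale^~ f : a b / a + b}.
Proof. by move=> a b; apply: polyfamP => n; exact: scalerDl. Qed.
HB.instance Definition _ := GRing.Zmodule_isLmodule.Build rat polyfam
  polyfam_scaleA polyfam_scale1 polyfam_scaleDr polyfam_scaleDl.

Fact polyfam_scaleAl a f g : a *: (f * g) = (a *: f) * g.
Proof. by apply: polyfamP => n; exact: scalerAl. Qed.
HB.instance Definition _ := GRing.Lmodule_isLalgebra.Build rat polyfam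
  polyfam_scaleAl.
HB.instance Definition _ := GRing.Lalgebra_isComAlgebra.Build rat polyfam.

End PolyfamAlgebra.

(* Substitution of 0 for the last variable. *)
Definition drop_var n (p : {mpoly rat[n.+1]}) : {mpoly rat[n]} :=
  p \mPo [tuple (if unlift ord_max i is Some j then 'X_j else 0) | i < n.+1].

Definition symfun (f : polyfam) : Prop :=
  [/\ forall n, f n \is symmetric,
      forall n, drop_var (f n.+1) = f n
    & exists d, forall n, (msize (f n) <= d)%N].

Section LinearNotions.
Variable A : comAlgType rat.
Implicit Types (D G P : A -> Prop).

Definition subalgebra P : Prop :=
  [/\ P 1, forall (a : rat) f g, P f -> P g -> P (a *: f + g)
    & forall f g, P f -> P g -> P (f * g)].

(* D is the smallest unital subalgebra containing G. *)
Definition generated_by D G : Prop :=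
  forall f, D f <->
    (forall P, subalgebra P -> (forall g, G g -> P g) -> P f).

Definition spanned_by (I : Type) D (v : I -> A) : Prop :=
  forall f, D f <->
    exists (s : seq I) (c : I -> rat), f = \sum_(i <- s) c i *: v i.

Definition lin_indep (I : eqType) (v : I -> A) : Prop :=
  forall (s : seq I) (c : I -> rat), uniq s ->
    \sum_(i <- s) c i *: v i = 0 -> forall i, i \in s -> c i = 0.

Definition is_basis_of (I : eqType) D (v : I -> A) : Prop :=
  spanned_by D v /\ lin_indep v.
End LinearNotions.

Definition is_partition (s : seq nat) : bool :=
  sorted geq s && all (leq 1) s.

Record intpart := IntPart { parts :> seq nat; _ : is_partition parts }.
HB.instance Definition _ := [isSub for parts].
HB.instance Definition _ := [Choice of intpart by <:].

Definition odd_partition (lam : intpart) : bool := all odd lam.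

(* The functions below take bare sequences of naturals, but are only meant for
   sequences satisfying is_partition. *)

Definition conj_part (lam : seq nat) : seq nat :=
  [seq count (ltn j) lam | j <- iota 0 (head 0%N lam)].

Fixpoint box_seqs (lam : seq nat) : seq (seq nat) :=
  if lam is r :: lam' then
    [seq x :: m | x <- iota 0 r.+1, m <- box_seqs lam']
  else [:: [::]].

(* Sequences in the box may have trailing zeros, which are removed. *)
Definition subpartitions (lam : seq nat) : seq (seq nat) :=
  [seq [seq x <- m | 0 < x]%N | m <- box_seqs lam & sorted geq m].

Lemma mem_box_seqs lam m :
  (m \in box_seqs lam) =
  (size m == size lam) && [forall i : 'I_(size m), nth 0 m i <= nth 0 lam i]%N.
Proof.
elim: lam m => [|r lam IH] m.
  rewrite inE; case: m => [|x m] //=; apply/esym/forallP => -[] //.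
rewrite -[box_seqs _]/[seq x :: m | x <- iota 0 r.+1, m <- box_seqs lam].
apply/allpairsP/andP => [[[y q] [yr qb ->]]|[]].
  move: yr qb; rewrite mem_iota IH => /= yr /andP[/eqP sq /forallP h].
  rewrite sq eqxx; split=> //; apply/forallP => -[[|i] hi] //=.
  by have hi2 : (i < size q)%N; [rewrite sq | exact: (h (Ordinal hi2))].
case: m => [|x m] // sz /forallP h; exists (x, m).
split=> //; first by rewrite mem_iota; exact: (h ord0).
by rewrite IH -eqSS sz; apply/forallP => i; exact: (h (lift ord0 i)).
Qed.

Lemma sorted_geqE m : sorted geq m ->
  m = [seq x <- m | 0 < x]%N ++ nseq (size m - size [seq x <- m | 0 < x]%N) 0%N.
Proof.
elim: m => [|x m IH] //= pm; have sm := path_sorted pm.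
have [x0|x0] := posnP x; last by rewrite /= subSS -IH.
have m0 y : y \in m -> y = 0%N.
  have := order_path_min (rev_trans leq_trans) pm => /allP h /h.
  by rewrite x0 /= leqn0 => /eqP.
have -> : [seq x <- m | 0 < x]%N = [::].
  by apply/eqP; rewrite -(negbK (_ == _)) -has_filter; apply/hasPn => y /m0 ->.
by rewrite x0 /=; congr cons; apply/all_pred1P/allP => y /m0 ->.
Qed.

Lemma mem_subpartitions lam mu : is_partition lam ->
  reflect (is_partition mu /\ forall i, (nth 0 mu i <= nth 0 lam i)%N)
          (mu \in subpartitions lam).
Proof.
move=> plam; apply: (iffP mapP) => [[m]|[/andP[smu pmu] hle]].
  rewrite mem_filter mem_box_seqs => /and3P[sm /eqP sz /forallP hm] ->.
  split.
    by rewrite /is_partition filter_all sorted_filter //; exact: rev_trans leq_trans.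
  move=> i; set mu' := filter _ _.
  have [hi|hi] := ltnP i (size mu'); last by rewrite nth_default.
  have him : (i < size m)%N.
    by apply: leq_trans hi _; rewrite size_filter; exact: count_size.
  have := hm (Ordinal him); rewrite /= {1}(sorted_geqE sm) nth_cat.
  by rewrite -/mu' hi.
have hs : (size mu <= size lam)%N.
  rewrite leqNgt; apply/negP => hlt; have := hle (size lam).
  by rewrite (nth_default 0%N (leqnn (size lam))) leqNgt (allP pmu) ?mem_nth.
exists (mu ++ nseq (size lam - size mu) 0%N); last first.
  rewrite filter_cat (all_filterP pmu) filter_nseq cats0 //.
rewrite mem_filter mem_box_seqs size_cat size_nseq subnKC // eqxx /=.
apply/andP; split; last first.
  apply/forallP => -[i hi] /=; rewrite nth_cat; case: ifP => _ //.
  by rewrite nth_nseq if_same.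
rewrite sorted_pairwise; last exact: rev_trans leq_trans.
rewrite pairwise_cat -!sorted_pairwise; try exact: rev_trans leq_trans.
rewrite smu /=; apply/andP; split.
  by apply/allrelP => x y _ /nseqP[-> _].
by elim: (_ - _)%N => [|[|n] IH] //=.
Qed.

Lemma subpartitions_uniq lam : uniq (subpartitions lam).
Proof.
rewrite map_inj_in_uniq; last first.
  move=> m1 m2; rewrite !mem_filter !mem_box_seqs.
  move=> /and3P[s1 /eqP z1 _] /and3P[s2 /eqP z2 _] e.
  by rewrite (sorted_geqE s1) (sorted_geqE s2) e z1 z2.
apply: filter_uniq; elim: lam => [|r lam IH] //.
apply: allpairs_uniq => //; first exact: iota_uniq.
by move=> [x m] [y q] _ _ [-> ->].
Qed.

(* The skew diagram lam / mu inside its bounding box, rows and columns being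
   numbered from 0. *)
Definition in_skew (lam mu : seq nat)
    (c : 'I_(size lam) * 'I_(head 0%N lam)) : bool :=
  (nth 0 mu c.1 <= c.2 < nth 0 lam c.1)%N.

Definition cell (lam mu : seq nat) := {c | in_skew (lam := lam) mu c}.

Section Tableaux.
Variables lam mu : seq nat.

Definition row_of (c : cell lam mu) : nat := (val c).1.
Definition col_of (c : cell lam mu) : nat := (val c).2.

(* c lies strictly to the left of d in the same row *)
Definition left_of (c d : cell lam mu) : bool :=
  (row_of c == row_of d) && (col_of c < col_of d)%N.
(* c lies strictly above d in the same column *)
Definition above (c d : cell lam mu) : bool :=
  (col_of c == col_of d) && (row_of c < row_of d)%N.

Definition semistandard n (T : {ffun cell lam mu -> 'I_n}) : bool :=
  [forall c, forall d, (left_of c d ==> (T c <= T d)%N) &&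
                       (above c d ==> (T c < T d)%N)].

(* The letters 1 < ... < k < 1' < ... < l' are encoded as 'I_(k + l), so that
   a letter is unprimed iff its value is smaller than k. *)
Definition kl_semistandard k l (T : {ffun cell lam mu -> 'I_(k + l)}) : bool :=
  [forall c, forall d,
    (left_of c d ==> (T c <= T d)%N && ((T c == T d) ==> (T c < k)%N)) &&
    (above c d ==> (T c <= T d)%N && ((T c == T d) ==> (k <= T c)%N))].

Definition tableau_weight n (T : {ffun cell lam mu -> 'I_n}) : {mpoly rat[n]} :=
  \prod_c 'X_(T c).
End Tableaux.

Definition skew_schur (lam mu : seq nat) : polyfam := fun n =>
  \sum_(T : {ffun cell lam mu -> 'I_n} | semistandard T) tableau_weight T.

Definition schur (lam : seq nat) : polyfam := skew_schur lam [::].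

(* The first k variables of {mpoly rat[k + l]} are X, the last l are Y. *)
Definition hook_schur (lam : seq nat) k l : {mpoly rat[k + l]} :=
  \sum_(T : {ffun cell lam [::] -> 'I_(k + l)} | kl_semistandard T)
    tableau_weight T.

(* The coefficients m_lam are c lam for lam in the duplicate-free list s, and 0
   for all other partitions. *)
Definition doubly_symmetric (f : polyfam) : Prop :=
  symfun f /\
  exists (s : seq intpart) (c : intpart -> rat),
    [/\ uniq s, f = \sum_(lam <- s) c lam *: schur lam
      & forall k l : nat,
          \sum_(lam <- s) c lam *: schur lam (k + l)%N =
          \sum_(lam <- s) c lam *: hook_schur lam k l].

Definition powersum (r : nat) : polyfam := fun n => \sum_(i < n) 'X_i ^+ r.

Definition powersum_part (lam : seq nat) : polyfam :=
  \prod_(r <- lam) powersum r.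

Definition double_schur (lam : seq nat) : polyfam :=
  \sum_(mu <- subpartitions lam)
    schur mu * skew_schur (conj_part lam) (conj_part mu).

Definition hook_sum (n : nat) : polyfam :=
  \sum_(ab : 'I_n.+1 * 'I_n.+1 | ((ab.1 + ab.2 == n) && (1 <= ab.1))%N)
    schur ((ab.1 : nat) :: nseq ab.2 1%N).

(* Main.v *)
(** A function is doubly symmetric iff the supersymmetric specialisation
    p_r |-> p_r(X) - (-1)^r p_r(Y) does not change it.  Schur functions over an
    arbitrary signed alphabet satisfy the branching rule (horizontal strips for
    an unprimed letter, vertical strips for a primed one), and so does the
    Jacobi-Trudi determinant in the complete functions h_m of that alphabet, by
    row operations.  Together with Newton's identities and the triangularity of
    Jacobi-Trudi, this gives linear relations between Schur functions, products
    of h_m and products of p_r whose coefficients do not depend on the alphabet.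
    Hence S_lam(X, Y), HS_lam(X; Y) and DS_lam are the values of one expression
    at three signed alphabets: X and Y unprimed; X unprimed and Y primed; X
    unprimed together with a primed copy of X.  Setting Y = X in the definition of
    double symmetry multiplies p_lam by 2^l(lam) on one side, and by 2^l(lam) or 0
    (lam odd or not) on the other, so by linear independence of the p_lam only
    odd lam survive.  The third alphabet sends p_r to 2 p_r or 0, S_lam to DS_lam
    and h_n to 2 k_n. *)

Require Import Defs.
From mathcomp Require Import all_boot all_order all_algebra.
From mathcomp Require Import mpoly.
From mathcomp Require Import boolp perm zify ring.

Set Implicit Arguments.
Unset Strict Implicit.
Unset Printing Implicit Defensive.

Import GRing.Theory.
Local Open Scope ring_scope.

(** * Partitions *)

Section Partitions.
Implicit Types (lam mu nu : seq nat) (i j : nat).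

Definition subshape mu lam := forall i, (nth 0 mu i <= nth 0 lam i)%N.

Lemma part_sorted lam : is_partition lam -> sorted geq lam.
Proof. by case/andP. Qed.

Lemma sorted_nth_geq lam i j : sorted geq lam -> (i <= j)%N ->
  (nth 0 lam j <= nth 0 lam i)%N.
Proof.
move=> slam le_ij; have [hj|hj] := ltnP j (size lam); last by rewrite nth_default.
have := sorted_leq_nth (rev_trans leq_trans) leqnn 0%N slam.
by apply; rewrite ?inE //; apply: leq_ltn_trans hj.
Qed.

Lemma part_nth_geq lam i j : is_partition lam -> (i <= j)%N ->
  (nth 0 lam j <= nth 0 lam i)%N.
Proof. by move=> /part_sorted; apply: sorted_nth_geq. Qed.

Lemma part_nth_gt0 lam i : is_partition lam ->
  (0 < nth 0 lam i)%N = (i < size lam)%N.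
Proof.
case/andP=> _ /allP h; have [hi|hi] := ltnP i (size lam).
  by apply: h; rewrite mem_nth.
by rewrite nth_default.
Qed.

Lemma eq_part lam mu : is_partition lam -> is_partition mu ->
  (forall i, nth 0 lam i = nth 0 mu i) -> lam = mu.
Proof.
move=> plam pmu e; apply: (@eq_from_nth _ 0%N) => //.
apply/eqP; rewrite eqn_leq; apply/andP; split; rewrite leqNgt.
  by apply/negP; rewrite -(part_nth_gt0 _ plam) e part_nth_gt0 // ltnn.
by apply/negP; rewrite -(part_nth_gt0 _ pmu) -e part_nth_gt0 // ltnn.
Qed.

Lemma subshape_size mu lam : is_partition mu -> is_partition lam ->
  subshape mu lam -> (size mu <= size lam)%N.
Proof.
move=> pmu plam h; rewrite leqNgt; apply/negP.
rewrite -(part_nth_gt0 _ pmu) => /leq_trans /(_ (h _)).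
by rewrite part_nth_gt0 // ltnn.
Qed.

Lemma subshape_trans mu nu lam :
  subshape mu nu -> subshape nu lam -> subshape mu lam.
Proof. by move=> h1 h2 i; apply: leq_trans (h1 i) (h2 i). Qed.

Lemma nth_filter_pos lam i : sorted geq lam ->
  nth 0 [seq x <- lam | 0 < x]%N i = nth 0 lam i.
Proof.
move=> slam; rewrite [in RHS](sorted_geqE slam) nth_cat.
by case: ltnP => // hi; rewrite nth_nseq if_same nth_default.
Qed.

Lemma filter_pos_part lam : sorted geq lam ->
  is_partition [seq x <- lam | 0 < x]%N.
Proof.
move=> slam; rewrite /is_partition filter_all sorted_filter //.
exact: rev_trans leq_trans.
Qed.

Lemma part_of_fun (f : nat -> nat) n :
  (forall i, (f i.+1 <= f i)%N) -> (forall i, (n <= i)%N -> f i = 0%N) ->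
  exists2 nu, is_partition nu & forall i, nth 0 nu i = f i.
Proof.
move=> hf h0.
have s : sorted geq (mkseq f n).
  apply: (@path_sorted _ _ (f 0%N)); apply/(pathP 0%N) => i.
  rewrite size_mkseq => hi; rewrite nth_mkseq //.
  by case: i hi => [|i] hi //=; rewrite nth_mkseq // ltnW.
exists [seq x <- mkseq f n | 0 < x]%N; first exact: filter_pos_part.
move=> i; rewrite nth_filter_pos //; have [hi|hi] := ltnP i n.
  by rewrite nth_mkseq.
by rewrite nth_default ?size_mkseq // h0.
Qed.

Lemma sumn_nth lam n : (size lam <= n)%N ->
  sumn lam = (\sum_(i < n) nth 0 lam i)%N.
Proof.
move=> h; rewrite sumnE (big_nth 0%N) -(big_mkord xpredT (nth 0%N lam)).
rewrite [RHS](big_cat_nat (n := size lam)) //= [X in (_ + X)%N]big1_seq ?addn0 //.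
by move=> i /andP[_]; rewrite mem_index_iota => /andP[hi _]; rewrite nth_default.
Qed.

Lemma sub_part lam mu : is_partition lam -> mu \in subpartitions lam ->
  is_partition mu.
Proof. by move=> plam /mem_subpartitions -/(_ plam)[]. Qed.

Lemma sub_subshape lam mu : is_partition lam -> mu \in subpartitions lam ->
  subshape mu lam.
Proof. by move=> plam /mem_subpartitions -/(_ plam)[]. Qed.

Lemma subshape_sumn mu lam : is_partition mu -> is_partition lam ->
  subshape mu lam ->
  (sumn lam - sumn mu = \sum_(i < size lam) (nth 0 lam i - nth 0 mu i))%N.
Proof.
move=> pmu plam h; rewrite (sumn_nth (leqnn _)) (sumn_nth (subshape_size pmu plam h)).
by rewrite sumnB.
Qed.

(** Both sides say that the cell [(i, j)] belongs to the diagram of [lam]. Since entries beyond the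
    end are 0, this covers all indices. *)
Lemma nth_conj_part lam i j : is_partition lam ->
  (i < nth 0 (conj_part lam) j)%N = (j < nth 0 lam i)%N.
Proof.
move=> plam; rewrite /conj_part.
have [hj|hj] := ltnP j (head 0%N lam); last first.
  rewrite nth_default ?size_map ?size_iota // ltn0; apply/esym/negbTE.
  by rewrite -leqNgt (leq_trans (part_nth_geq plam (leq0n i))) // nth0.
rewrite (nth_map 0%N) ?size_iota // nth_iota // add0n.
have : sorted geq lam := part_sorted plam.
elim: lam i {plam hj} => [|x lam IH] i //=; first by rewrite nth_nil.
move=> hp; have sl := path_sorted hp.
case: i => [|i] /=; last first.
  rewrite -IH //; have [//|hx] := ltnP j x.
  have -> : count (ltn j) lam = 0%N.
    apply/eqP; rewrite -leqn0 leqNgt -has_count; apply/hasPn => y hy /=.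
    rewrite -leqNgt; apply: leq_trans hx.
    by have /allP := order_path_min (rev_trans leq_trans) hp; apply.
  by rewrite !ltn0.
have [//|hx] := ltnP j x; rewrite add0n -has_count; apply/negbTE.
apply/hasPn => y hy /=; rewrite -leqNgt; apply: leq_trans hx.
by have /allP := order_path_min (rev_trans leq_trans) hp; apply.
Qed.

End Partitions.

(** * Tableaux over signed alphabets *)

(* An alphabet is a sequence of letters 0 < 1 < ..., the i-th one carrying the
   variable w i; it is unprimed when sg i holds and primed otherwise. *)
Section Branching.
Variable K : comNzRingType.
Implicit Types (sg : nat -> bool) (w : nat -> K) (lam mu nu : seq nat).

(** For [nu] contained in [lam]: the skew shape is a horizontal strip if [b], a vertical strip
    otherwise. The containment itself comes from [subpartitions]. *)
Definition strip (b : bool) nu lam : bool :=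
  all (fun i => if b then nth 0 lam i.+1 <= nth 0 nu i
                else nth 0 lam i <= (nth 0 nu i).+1)%N (iota 0 (size lam)).

Lemma stripP b nu lam : reflect
  (forall i, (if b then nth 0 lam i.+1 <= nth 0 nu i
              else nth 0 lam i <= (nth 0 nu i).+1)%N) (strip b nu lam).
Proof.
apply: (iffP allP) => h i; last by move=> _; exact: h.
have [hi|hi] := ltnP i (size lam); first by apply: h; rewrite mem_iota.
by case: b {h}; rewrite (@nth_default _ _ lam) ?leqW.
Qed.

(** The skew Schur function of [lam / mu] in the first [n] letters, as a sum over chains of
    partitions from [mu] to [lam]; the largest letter is peeled off first. *)
Fixpoint branch sg w n mu lam : K :=
  if n is n'.+1 then
    \sum_(nu <- subpartitions lam | strip (sg n') nu lam)
       w n' ^+ (sumn lam - sumn nu) * branch sg w n' mu nu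
  else (mu == lam)%:R.

Lemma branch_eq0 sg w n mu lam : is_partition lam ->
  ~ subshape mu lam -> branch sg w n mu lam = 0.
Proof.
elim: n lam => [|n IH] lam plam hsub /=.
  by case: eqP => // e; case: hsub; rewrite e => i; apply: leqnn.
rewrite big_seq_cond big1 // => nu /andP[hnu _].
rewrite IH ?mulr0 //; first exact: sub_part hnu.
by move=> h; apply: hsub; apply: subshape_trans h (sub_subshape plam hnu).
Qed.

(** A chain is cut at the partition [nu] reached after the first [n] letters. The first factor may
    use any alphabet that agrees on these letters, so that later it can be the plain one. *)
Lemma branch_concat sg w sg' w' n m lam : is_partition lam ->
  (forall i, (i < n)%N -> sg i = sg' i /\ w i = w' i) ->
  branch sg w (n + m) [::] lam =
  \sum_(nu <- subpartitions lam) branch sg' w' n [::] nu *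
     branch (fun i => sg (n + i)%N) (fun i => w (n + i)%N) m nu lam.
Proof.
move=> plam hn; elim: m lam plam => [|m IH] lam plam /=.
  have hl : lam \in subpartitions lam by apply/mem_subpartitions.
  rewrite addn0 [RHS](bigD1_seq lam) //= ?subpartitions_uniq // eqxx mulr1.
  rewrite [X in _ + X]big1_seq ?addr0 => [|nu /andP[/negbTE -> _]]; last by rewrite mulr0.
  elim: n lam hn {plam hl} => [|n IH] lam hn //=.
  have [-> ->] := hn n (ltnSn n).
  by apply: eq_bigr => nu _; rewrite IH // => i hi; apply: hn; apply: ltnW.
rewrite addnS /=.
transitivity (\sum_(kap <- subpartitions lam | strip (sg (n + m)%N) kap lam)
  \sum_(nu <- subpartitions lam) branch sg' w' n [::] nu *
   (w (n + m)%N ^+ (sumn lam - sumn kap) *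
   branch (fun i => sg (n + i)%N) (fun i => w (n + i)%N) m nu kap)); last first.
  by rewrite exchange_big /=; apply: eq_bigr => nu _; rewrite big_distrr.
rewrite big_seq_cond [RHS]big_seq_cond; apply: eq_bigr => kap /andP[hk _].
(* A [nu] outside [kap] contributes 0 by [branch_eq0], so the sum over subpartitions of [lam]
   shrinks to those of [kap]. *)
have pk := sub_part plam hk; rewrite IH // big_distrr /=.
rewrite [RHS](bigID (fun nu => nu \in subpartitions kap)) /=.
rewrite [X in _ = _ + X]big1_seq ?addr0; last first.
  move=> nu /andP[hnk hnl]; rewrite [X in _ * (_ * X)]branch_eq0 ?mulr0 // => h; case/negP: hnk.
  by apply/mem_subpartitions => //; split; rewrite ?(sub_part plam hnl).
rewrite -[RHS]big_filter; apply: etrans (perm_big _ _) _; last first.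
  by apply: eq_bigr => nu _; rewrite mulrCA.
apply: uniq_perm; rewrite ?filter_uniq ?subpartitions_uniq // => nu.
rewrite mem_filter; case: (boolP (nu \in subpartitions kap)) => //= hnk.
apply/esym/mem_subpartitions => //; split; first exact: sub_part hnk.
exact: subshape_trans (sub_subshape pk hnk) (sub_subshape plam hk).
Qed.

End Branching.

Section SignedTableaux.
Variables (I : finType) (row col : I -> nat).

Definition signed_rule (sg : nat -> bool) (c d : I) (x y : nat) : bool :=
  (((row c == row d) && (col c < col d)) ==>
     (x <= y) && ((x == y) ==> sg x))%N &&
  (((col c == col d) && (row c < row d)) ==>
     (x <= y) && ((x == y) ==> ~~ sg x))%N.

Definition signed_tab sg n (T : {ffun I -> 'I_n}) : bool :=
  [forall c, forall d, signed_rule sg c d (T c) (T d)].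

(** Cells are an abstract finite type with two coordinates, so that the count below also applies to
    the cells of the conjugate shape with rows and columns exchanged. *)
Definition presents (lam mu : seq nat) : Prop :=
  (injective (fun c => (row c, col c))) /\
  forall i j, (nth 0 mu i <= j < nth 0 lam i)%N <->
              exists c, row c = i /\ col c = j.

Variables (K : comNzRingType) (sg : nat -> bool) (w : nat -> K).
Variables (lam mu : seq nat).
Hypotheses (plam : is_partition lam) (pmu : is_partition mu).
Hypothesis Ipres : presents lam mu.

Definition inside (nu : seq nat) (c : I) : bool := (col c < nth 0 nu (row c))%N.

Lemma insideP nu i j : subshape nu lam -> (nth 0 mu i <= j < nth 0 nu i)%N ->
  exists c, [/\ row c = i, col c = j & inside nu c].
Proof.
move=> hs /andP[h1 h2]; have [_ /(_ i j) [h _]] := Ipres.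
have [|c [rc cc]] := h; first by rewrite h1 (leq_trans h2 (hs i)).
by exists c; rewrite /inside rc cc.
Qed.

Lemma col_ge c : (nth 0 mu (row c) <= col c)%N.
Proof.
have [_ /(_ (row c) (col c)) [_ h]] := Ipres.
by have /andP[] := h (ex_intro _ c (conj erefl erefl)).
Qed.

Section Partial.
Variable M : nat.

(* The cells outside nu / mu carry the dummy value M. *)
Definition partial_tab N nu (T : {ffun I -> 'I_M.+1}) : bool :=
  [forall c, if inside nu c then T c < N else T c == M :> nat]%N &&
  [forall c, forall d, inside nu c && inside nu d ==>
                       signed_rule sg c d (T c) (T d)].

Definition partial_sum N nu : K :=
  \sum_(T | partial_tab N nu T) \prod_(c | inside nu c) w (T c).

(** [kap] is the shape occupied by the letters below [N]. *)
Definition splits N nu (T : {ffun I -> 'I_M.+1}) kap : bool :=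
  [forall c, inside nu c ==> ((T c < N)%N == inside kap c)].

Lemma partial_sum0 nu : is_partition nu -> subshape mu nu -> subshape nu lam ->
  partial_sum 0 nu = (mu == nu)%:R.
Proof.
move=> pnu hmn hnl; rewrite /partial_sum; case: eqP => [e|ne].
  have hi c : inside nu c = false.
    by apply/negbTE; rewrite /inside -leqNgt -e col_ge.
  rewrite (big_pred1 [ffun=> ord_max]) => [|T].
    by rewrite big_pred0.
  apply/andP/eqP => [[/forallP h _]|->].
    by apply/ffunP => c; rewrite ffunE; apply: val_inj; have := h c; rewrite hi => /eqP.
  split; apply/forallP => c; first by rewrite hi ffunE.
  by apply/forallP => d; rewrite hi.
rewrite big_pred0 // => T; apply/negbTE/negP => /andP[/forallP h _].
case: ne; apply: eq_part => // i; apply/eqP; rewrite eqn_leq hmn leqNgt.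
apply/negP => hi; have [|c [_ _ hc]] := @insideP nu i (nth 0 mu i)%N hnl.
  by rewrite leqnn.
by have := h c; rewrite hc.
Qed.

(** Entries increase weakly along rows and columns, so those below [N] fill an initial segment of
    each row, and the lengths of these segments decrease from row to row. *)
Lemma splits_ex N nu T : is_partition nu -> subshape mu nu -> subshape nu lam ->
  partial_tab N.+1 nu T ->
  exists kap, [/\ is_partition kap, subshape mu kap, subshape kap nu & splits N nu T kap].
Proof.
move=> pnu hmn hnl /andP[/forallP hT /forallP hR].
have rule c d : inside nu c -> inside nu d -> signed_rule sg c d (T c) (T d).
  by move=> hc hd; have /forallP/(_ d)/implyP -> := hR c; rewrite ?hc.
(* This holds vacuously at the positions of [mu], so the row length [f i] below also counts the
   columns of [mu]. *)
pose P i j := [forall c, (row c == i) && (col c == j) ==> (T c < N)%N].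
have Pdown i j j' : (j <= j' < nth 0 nu i)%N -> P i j' -> P i j.
  move=> /andP[jj' hj'] /forallP h; apply/forallP => c; apply/implyP => /andP[/eqP rc /eqP cc].
  have hm := col_ge c; rewrite rc cc in hm.
  have [|d [rd cd id]] := @insideP nu i j' hnl; first by rewrite hj' (leq_trans hm).
  have := h d; rewrite rd cd !eqxx /= => hd.
  have [e|ne] := eqVneq j j'.
    have -> // : c = d by have [inj _] := Ipres; apply: inj; rewrite rc cc rd cd e.
  have ic : inside nu c by rewrite /inside rc cc (leq_ltn_trans jj').
  have := rule c d ic id; rewrite /signed_rule rc rd eqxx cc cd ltn_neqAle ne jj' /=.
  by case/andP=> /andP[/leq_ltn_trans h' _] _; apply: h'.
pose f i := find (fun j => ~~ P i j) (iota 0 (nth 0 nu i)).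
have fle i : (f i <= nth 0 nu i)%N.
  by rewrite -[leqRHS](size_iota 0) find_size.
have fP i j : (j < nth 0 nu i)%N -> (j < f i)%N = P i j.
  move=> hj; have [hf|hf] := ltnP j (f i).
    by have := before_find 0%N hf; rewrite nth_iota // => /negbFE.
  have hff : (f i < nth 0 nu i)%N := leq_ltn_trans hf hj.
  have := @nth_find _ 0%N (fun j => ~~ P i j) (iota 0 (nth 0 nu i)).
  rewrite has_find size_iota -/(f i) => /(_ hff); rewrite nth_iota // add0n => hn.
  by apply/esym/negbTE; apply: contra hn => hP; apply: Pdown hP; rewrite hf.
have PN i j : (j < nth 0 nu i)%N -> ~~ P i j ->
   exists c, [/\ row c = i, col c = j, inside nu c & (N <= T c)%N].
  move=> hj /forallPn[c]; rewrite negb_imply -leqNgt => /andP[/andP[/eqP rc /eqP cc] hN].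
  by exists c; rewrite /inside rc cc.
have [|i hi|kap pk kf] := @part_of_fun f (size nu).
(* Otherwise the cell [(i.+1, f i)], with an entry below [N], would lie under the cell [(i, f i)],
   whose entry is at least [N]. *)
- move=> i; rewrite leqNgt; apply/negP => hlt.
  have h1 : (f i < nth 0 nu i.+1)%N := leq_trans hlt (fle _).
  have h2 : (f i < nth 0 nu i)%N := leq_trans h1 (part_nth_geq pnu (leqnSn i)).
  have : ~~ P i (f i) by rewrite -fP // ltnn.
  case/(PN _ _ h2) => c [rc cc ic Tc].
  have hm := col_ge c; rewrite rc cc in hm.
  have [|d [rd cd id]] := @insideP nu i.+1 (f i) hnl.
    by rewrite h1 (leq_trans (part_nth_geq pmu (leqnSn i))).
  have : P i.+1 (f i) by rewrite -fP.
  move=> /forallP/(_ d); rewrite rd cd !eqxx /= => Td.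
  have := rule c d ic id; rewrite /signed_rule rc rd cc cd eqxx ltnSn /= => /andP[_ /andP[h _]].
  by move: (leq_ltn_trans h Td); rewrite ltnNge Tc.
- by apply/eqP; rewrite -leqn0 (leq_trans (fle i)) // nth_default.
exists kap; split=> // [i|i|]; rewrite ?kf //.
  rewrite leqNgt; apply/negP => hlt.
  have h2 : (f i < nth 0 nu i)%N := leq_trans hlt (hmn i).
  have : ~~ P i (f i) by rewrite -fP // ltnn.
  case/(PN _ _ h2) => c [rc cc _ _]; have := col_ge c.
  by rewrite rc cc leqNgt hlt.
apply/forallP => c; apply/implyP => ic; rewrite /inside kf fP //.
apply/eqP; apply/idP/forallP => [hc d|/(_ c)]; last by rewrite !eqxx.
apply/implyP => /andP[/eqP rd /eqP cd].
by have -> : d = c by have [inj _] := Ipres; apply: inj; rewrite rd cd.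
Qed.

Lemma splits_inj N nu T kap kap' : is_partition nu -> subshape nu lam ->
  is_partition kap -> subshape mu kap -> subshape kap nu ->
  is_partition kap' -> subshape mu kap' -> subshape kap' nu ->
  splits N nu T kap -> splits N nu T kap' -> kap = kap'.
Proof.
move=> pnu hnl pk mk kn pk' mk' kn' /forallP s1 /forallP s2.
suff h i k k' : subshape mu k -> subshape k' nu ->
    (forall c, inside nu c -> inside k c = inside k' c) -> (nth 0 k' i <= nth 0 k i)%N.
  have e c : inside nu c -> inside kap c = inside kap' c.
    by move=> ic; have := s1 c; have := s2 c; rewrite ic /= => /eqP <- /eqP.
  apply: eq_part => // i; apply/eqP; rewrite eqn_leq !h // => c ic.
  by rewrite e.
move=> hk hk' e; rewrite leqNgt; apply/negP => hlt.
have [|c [rc cc ic]] := @insideP nu i (nth 0 k i) hnl.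
  by rewrite hk (leq_trans hlt).
by have := e c ic; rewrite /inside rc cc ltnn hlt.
Qed.

(** All cells of [nu / kap] carry the letter [N]. A violation of the strip condition puts two of
    them next to each other in a column (unprimed) or in a row (primed), where equal entries are
    forbidden. *)
Lemma splits_strip N nu T kap : is_partition nu -> subshape nu lam ->
  is_partition kap -> subshape mu kap -> subshape kap nu ->
  partial_tab N.+1 nu T -> splits N nu T kap -> strip (sg N) kap nu.
Proof.
move=> pnu hnl pk mk kn /andP[/forallP hT /forallP hR] /forallP hs.
have rule c d : inside nu c -> inside nu d -> signed_rule sg c d (T c) (T d).
  by move=> hc hd; have /forallP/(_ d)/implyP -> := hR c; rewrite ?hc.
have TN c : inside nu c -> ~~ inside kap c -> T c = N :> nat.
  move=> ic nc; have := hs c; rewrite ic (negbTE nc) /= => /eqP/negbT.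
  by have := hT c; rewrite ic ltnS -leqNgt => h1 h2; apply/eqP; rewrite eqn_leq h1.
apply/stripP => i; case: ifPn => [sN|/negbTE sN]; rewrite leqNgt; apply/negP => hlt.
  have hi := part_nth_geq pnu (leqnSn i); have hm := part_nth_geq pmu (leqnSn i).
  have hki := part_nth_geq pk (leqnSn i).
  have [|c [rc cc ic]] := @insideP nu i (nth 0 kap i) hnl.
    by rewrite mk (leq_trans hlt).
  have [|d [rd cd id]] := @insideP nu i.+1 (nth 0 kap i) hnl.
    by rewrite hlt (leq_trans hm).
  have := rule c d ic id; rewrite /signed_rule rc rd cc cd eqxx ltnSn /= => /andP[_ /andP[_]].
  by rewrite !TN ?eqxx ?sN // /inside ?rc ?rd ?cc ?cd -leqNgt.
have [|c [rc cc ic]] := @insideP nu i (nth 0 kap i) hnl.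
  by rewrite mk (leq_trans _ hlt).
have [|d [rd cd id]] := @insideP nu i (nth 0 kap i).+1 hnl.
  by rewrite hlt (leq_trans (mk i)).
have := rule c d ic id; rewrite /signed_rule rc rd cc cd eqxx ltnSn /= => /andP[/andP[_]].
by rewrite !TN ?eqxx ?sN // /inside ?rc ?rd ?cc ?cd -leqNgt.
Qed.

Lemma card_inside nu kap : is_partition nu -> subshape nu lam ->
  is_partition kap -> subshape mu kap -> subshape kap nu ->
  #|[pred c | inside nu c && ~~ inside kap c]| = (sumn nu - sumn kap)%N.
Proof.
move=> pnu hnl pk mk kn; rewrite (subshape_sumn pk pnu kn).
rewrite cardE -(size_map (fun c => (row c, col c))).
set s := [seq (i, j) | i <- iota 0 (size nu), j <- iota (nth 0 kap i) (nth 0 nu i - nth 0 kap i)].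
have -> : size (map (fun c => (row c, col c)) (enum [pred c | inside nu c && ~~ inside kap c])) = size s.
  apply: perm_size; apply: uniq_perm.
  - by rewrite map_inj_uniq ?enum_uniq //; case: Ipres.
  - apply: allpairs_uniq_dep => [|i _|[i1 j1] [i2 j2] _ _ [-> ->]] //; exact: iota_uniq.
  move=> [i j]; apply/mapP/allpairsPdep => [[c]|[i' [j' [hi' hj' [-> ->]]]]].
    rewrite mem_enum /= => /andP[ic nc] [-> ->].
    exists (row c), (col c); split=> //.
      rewrite mem_iota add0n -part_nth_gt0 //=.
      by apply: leq_ltn_trans ic.
    rewrite mem_iota subnKC ?kn //; apply/andP; split; last exact: ic.
    by rewrite leqNgt.
  rewrite mem_iota subnKC ?kn // in hj'; case/andP: hj' => h1 h2.
  have [|c [rc cc ic]] := @insideP nu i' j' hnl.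
    by rewrite h2 (leq_trans (mk i')).
  by exists c; rewrite ?rc ?cc // mem_enum inE /= ic /inside rc cc -leqNgt.
rewrite size_allpairs_dep sumnE big_map -[size nu in RHS](size_iota 0).
rewrite size_iota -(big_mkord xpredT (fun i => nth 0 nu i - nth 0 kap i)%N) /index_iota subn0.
by apply: eq_bigr => i _; rewrite size_iota.
Qed.

(** Once [kap] is fixed, the rest of the tableau is forced: erasing the strip is a bijection onto
    the tableaux of shape [kap], and each erased cell accounts for one factor [w N]. *)
Lemma partial_sum_split N nu kap : (N < M)%N -> is_partition nu -> subshape nu lam ->
  is_partition kap -> subshape mu kap -> subshape kap nu -> strip (sg N) kap nu ->
  \sum_(T | partial_tab N.+1 nu T && splits N nu T kap)
     \prod_(c | inside nu c) w (T c) =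
  w N ^+ (sumn nu - sumn kap) * partial_sum N kap.
Proof.
move=> hNM pnu hnl pk mk kn /stripP hs.
have kin c : inside kap c -> inside nu c by move=> h; apply: leq_trans (kn _).
(* [up] fills the strip with the letter [N]; [down] resets everything outside [kap] to the dummy
   value [M]. *)
pose up (T : {ffun I -> 'I_M.+1}) : {ffun I -> 'I_M.+1} :=
  [ffun c => if inside kap c then T c else if inside nu c then inord N else ord_max].
pose down (T : {ffun I -> 'I_M.+1}) : {ffun I -> 'I_M.+1} :=
  [ffun c => if inside kap c then T c else ord_max].
have inN : @inord M N = N :> nat by rewrite inordK // ltnW.
rewrite (reindex_onto up down) => [|T /andP[/andP[/forallP hT _] /forallP sT]]; last first.
  apply/ffunP => c; rewrite !ffunE; have := hT c; have := sT c.
  case nk: (inside kap c) => //; case ic: (inside nu c) => /= h1 h2; apply: val_inj;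
    last by rewrite /= (eqP h2).
  move: h1 h2; rewrite /= inN => /eqP/negbT; rewrite -leqNgt ltnS => h1 h2.
  by apply/eqP; rewrite eqn_leq h1.
rewrite /partial_sum big_distrr /=; apply: eq_big => [T|T _]; last first.
  rewrite (bigID (inside kap)) /= mulrC; congr (_ * _); last first.
    apply: eq_big => [c|c /andP[ic ik]]; last by rewrite ffunE ik.
    by case h: (inside kap c); rewrite ?andbF ?andbT // kin.
  rewrite -(card_inside pnu hnl pk mk kn) -prodr_const.
  by apply: eq_bigr => c /andP[ic /negbTE nk]; rewrite ffunE nk ic inN.
apply/andP/andP => [[/andP[/andP[/forallP h1 /forallP h2] /forallP h3]] /eqP h4|
                    [/forallP h1 /forallP h2]].
  split; apply/forallP => c.
    case: ifP => ik; last by rewrite -h4 !ffunE ik.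
    by have := h3 c; rewrite kin // ik !ffunE ik => /eqP.
  apply/forallP => d; apply/implyP => /andP[ic id].
  by have /forallP/(_ d) := h2 c; rewrite !kin // !ffunE ic id.
split; last first.
  apply/eqP/ffunP => c; rewrite !ffunE; case ik: (inside kap c) => //.
  by apply: val_inj; have := h1 c; rewrite ik => /eqP.
rewrite /partial_tab -andbA; apply/and3P; split; apply/forallP => c; have := h1 c.
- rewrite ffunE; case ik: (inside kap c); first by rewrite kin // => /ltnW.
  by case: (inside nu c) => //=; rewrite inN.
- move=> hc; apply/forallP => d; apply/implyP => /andP[ic id].
  rewrite /signed_rule !ffunE ic id; have := h1 d; move: hc.
  (* Four cases: both cells in [kap], where the rule is inherited; only [c], whose entry is below
     [N]; only [d], impossible since a cell left of or above a cell of [kap] is in [kap]; neither,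
     where the strip condition excludes a repetition of the wrong kind. *)
  case ick: (inside kap c) => hc; case idk: (inside kap d) => hd.
  + by have /forallP/(_ d) := h2 c; rewrite ick idk.
  + by rewrite inN (ltnW hc) (ltn_eqF hc) !implybT.
  + rewrite /inside in ick idk; apply/andP; split; apply/implyP => /andP[/eqP e hlt].
      by move: idk ick; rewrite -e => /(ltn_trans hlt) ->.
    by move: idk ick; rewrite -e => /leq_trans/(_ (part_nth_geq pk (ltnW hlt))) ->.
  + rewrite inN leqnn eqxx /=; rewrite /inside in ick idk ic id.
    apply/andP; split; apply/implyP => /andP[/eqP e hlt].
      have := hs (row c); case: ifP => // _ h; move: ick; rewrite -e in id.
      by have -> // : (col c < nth 0 kap (row c))%N; lia.
    have := hs (row c); case: ifP => // _ h; move: ick; rewrite e.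
    by have -> // := leq_trans (leq_trans id (part_nth_geq pnu hlt)) h.
- move=> hc; apply/implyP => ic; rewrite ffunE ic; move: hc.
  by case: (inside kap c) => /=; [move=> -> | rewrite inN ltnn].
Qed.

(** Induction on [N] with [M] fixed: the tableaux are grouped by the shape of their letters below
    [N], which [splits_ex] and [splits_inj] show to exist and to be unique. *)
Lemma partial_sum_branch N nu : (N <= M)%N ->
  is_partition nu -> subshape mu nu -> subshape nu lam ->
  partial_sum N nu = branch sg w N mu nu.
Proof.
elim: N nu => [|N IH] nu hN pnu hmn hnl; first exact: partial_sum0.
have dec (kap : seq nat) : reflect (subshape mu kap)
    (all (fun i => nth 0 mu i <= nth 0 kap i)%N (iota 0 (size mu))).
  apply: (iffP allP) => h i; last by move=> _; apply: h.
  have [hi|hi] := ltnP i (size mu); first by apply: h; rewrite mem_iota.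
  by rewrite nth_default.
set s := [seq kap <- subpartitions nu |
            all (fun i => nth 0 mu i <= nth 0 kap i)%N (iota 0 (size mu))].
have sP kap : kap \in s -> [/\ is_partition kap, subshape mu kap & subshape kap nu].
  rewrite mem_filter => /andP[/dec h1 h2].
  by split=> //; [exact: sub_part h2 | exact: sub_subshape h2].
have us : uniq s by apply: filter_uniq; exact: subpartitions_uniq.
transitivity (\sum_(kap <- s) \sum_(T | partial_tab N.+1 nu T && splits N nu T kap)
     \prod_(c | inside nu c) w (T c)).
  under [RHS]eq_bigr do rewrite big_mkcondr.
  rewrite [RHS]exchange_big /=; apply: eq_bigr => T hT.
  have [kap [pk mk kn sk]] := splits_ex pnu hmn hnl hT.
  have ks : kap \in s.
    by rewrite mem_filter; apply/andP; split; [apply/dec | apply/mem_subpartitions].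
  rewrite (bigD1_seq kap) //= sk [X in _ + X]big1_seq ?addr0 // => kap' /andP[ne /sP[pk' mk' kn']].
  case: ifP => // sk'; case/eqP: ne.
  exact: (splits_inj pnu hnl pk' mk' kn' pk mk kn sk' sk).
rewrite [RHS]/= [RHS](bigID (fun kap => kap \in s)) /= [X in _ = _ + X]big1_seq ?addr0; last first.
  move=> kap /andP[/andP[_ ns] hk]; rewrite branch_eq0 ?mulr0 //.
    exact: sub_part hk.
  by move=> /dec h; move: ns; rewrite mem_filter h hk.
rewrite [RHS](_ : _ = \sum_(kap <- s | strip (sg N) kap nu)
   w N ^+ (sumn nu - sumn kap) * branch sg w N mu kap); last first.
  rewrite [in RHS]/s big_filter_cond big_seq_cond [in RHS]big_seq_cond.
  by apply: eq_bigl => kap; rewrite mem_filter; case: (kap \in _); rewrite ?andbF //= andbT andbC.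
rewrite [RHS]big_mkcond big_seq [RHS]big_seq; apply: eq_bigr => kap /sP[pk mk kn].
case: ifP => hs; last first.
  rewrite big_pred0 // => T; apply/negbTE/negP => /andP[hT sk].
  by rewrite (splits_strip pnu hnl pk mk kn hT sk) in hs.
rewrite partial_sum_split // IH //; first exact: ltnW.
exact: subshape_trans kn hnl.
Qed.

End Partial.

(** This is the case [nu = lam], [N = M = n] of [partial_sum_branch]: no cell lies outside [lam], so
    the dummy value never occurs and the entries can be read in ['I_n]. *)
Theorem sum_signed_tab n : subshape mu lam ->
  \sum_(T : {ffun I -> 'I_n} | signed_tab sg T) \prod_c w (T c) =
  branch sg w n mu lam.
Proof.
move=> hml; have hll : subshape lam lam by move=> i; apply: leqnn.
rewrite -(@partial_sum_branch n) //.
have il c : inside lam c.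
  have [_ /(_ (row c) (col c)) [_ h]] := Ipres.
  have /andP[//] : (nth 0 mu (row c) <= col c < nth 0 lam (row c))%N by apply: h; exists c.
pose h (T : {ffun I -> 'I_n}) : {ffun I -> 'I_n.+1} :=
  [ffun c => widen_ord (leqnSn n) (T c)].
have hinj : injective h.
  move=> T1 T2 /ffunP e; apply/ffunP => c; apply: val_inj.
  by have := e c; rewrite !ffunE => /(congr1 val).
rewrite /partial_sum [RHS](eq_bigl (fun T => T \in h @: [set T | signed_tab sg T])).
  rewrite big_imset /=; last by move=> ? ? _ _ /hinj.
  apply: eq_big => [T|T _]; first by rewrite inE.
  by apply: eq_big => [c|c _]; rewrite ?il // ffunE.
move=> T; apply/andP/imsetP => [[/forallP h1 /forallP h2]|[T' + ->]].
  have lt c : (T c < n)%N by have := h1 c; rewrite il.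
  exists [ffun c => Ordinal (lt c)]; last first.
    by apply/ffunP => c; rewrite !ffunE; apply: val_inj.
  rewrite inE; apply/forallP => c; apply/forallP => d; rewrite !ffunE.
  by have /forallP/(_ d) := h2 c; rewrite !il.
rewrite inE => /forallP hT; split; apply/forallP => c; first by rewrite il ffunE /=.
apply/forallP => d; rewrite !il !ffunE; exact: (forallP (hT c) d).
Qed.

End SignedTableaux.

(** * The Jacobi-Trudi formula *)

Section JacobiTrudi.
Variable K : comNzRingType.
Implicit Types (h : nat -> K) (a : K) (lam mu nu : seq nat).

(* In generating functions: multiplication by 1 / (1 - a t) if b, by 1 + a t
   otherwise. *)
Definition add_letter (b : bool) a h : nat -> K :=
  fix f m := if m is m'.+1 then h m + a * (if b then f m' else h m') else h 0%N.

(** The complete supersymmetric functions: their generating function is the product of $1/(1-wt)$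
    over unprimed and of $1+wt$ over primed letters. *)
Fixpoint complete (sg : nat -> bool) (w : nat -> K) n : nat -> K :=
  if n is n'.+1 then add_letter (sg n') (w n') (complete sg w n')
  else fun m => (m == 0%N)%:R.

Lemma add_letterS b a h m : add_letter b a h m.+1 =
  h m.+1 + a * (if b then add_letter b a h m else h m).
Proof. by []. Qed.

Lemma complete0 sg w n : complete sg w n 0%N = 1.
Proof. by elim: n. Qed.

(* h of the possibly negative index m - i *)
Definition hdiff h (m i : nat) : K := if (i <= m)%N then h (m - i)%N else 0.

Lemma hdiffSS h m i : hdiff h m.+1 i.+1 = hdiff h m i.
Proof. by rewrite /hdiff ltnS subSS. Qed.

Lemma hdiff_add_letter b a h m i : hdiff (add_letter b a h) m i =
  hdiff h m i + a * hdiff (if b then add_letter b a h else h) m i.+1.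
Proof.
rewrite /hdiff; have [hlt|hgt|->] := ltngtP m i; last by rewrite subnn mulr0 addr0.
  by rewrite mulr0 addr0.
by have -> : (m - i = (m - i.+1).+1)%N by [lia]; rewrite add_letterS; case: b.
Qed.

Definition jt_mx h R lam : 'M[K]_R :=
  \matrix_(i, j) hdiff h (nth 0 lam i + j)%N i.

(** A zero part in the last row makes that row $(0,\ldots,0,1)$, because $h_0=1$ and negative
    indices give 0. *)
Lemma det_jt_widen h R lam : h 0%N = 1 -> (size lam <= R)%N ->
  \det (jt_mx h R lam) = \det (jt_mx h (size lam) lam).
Proof.
move=> h0; elim: R => [|R IH]; first by rewrite leqn0 => /eqP ->.
rewrite leq_eqVlt => /predU1P[-> //|]; rewrite ltnS => hR.
rewrite -IH // (expand_det_row _ ord_max) (bigD1 ord_max) //= big1 ?addr0.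
  rewrite mxE nth_default // add0n /hdiff leqnn subnn h0 mul1r /cofactor.
  rewrite -signr_odd oddD addbb mul1r; congr (\det _).
  by apply/matrixP => i j; rewrite !mxE !lift_max.
move=> j ne; rewrite mxE nth_default // add0n /hdiff leqNgt.
have -> : (j < @ord_max R)%N by rewrite ltn_neqAle ne -ltnS ltn_ord.
by rewrite mul0r.
Qed.

Lemma prod_sum_box lam (F : 'I_(size lam) -> nat -> K) :
  \prod_(i < size lam) \sum_(x < (nth 0 lam i).+1) F i x =
  \sum_(m <- box_seqs lam) \prod_(i < size lam) F i (nth 0 m i).
Proof.
elim: lam F => [|r lam IH] F; first by rewrite big_ord0 big_seq1 big_ord0.
rewrite -[box_seqs _]/[seq x :: m | x <- iota 0 r.+1, m <- box_seqs lam].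
rewrite big_allpairs_dep big_ord_recl /= big_distrl /=.
rewrite -(big_mkord xpredT (fun x => F ord0 x * _)) /index_iota subn0.
apply: eq_bigr => x _.
rewrite (IH (fun i => F (lift ord0 i))) big_distrr /=; apply: eq_bigr => m _.
by rewrite big_ord_recl.
Qed.

(** Multilinearity of the determinant in its rows: choosing one summand [x] per row amounts to
    choosing a sequence in the box. *)
Lemma det_sum_box h lam (c : nat -> nat -> K) :
  \det (\matrix_(i < size lam, j < size lam)
          \sum_(x < (nth 0 lam i).+1) c i x * hdiff h (x + j)%N i) =
  \sum_(m <- box_seqs lam) (\prod_(i < size lam) c i (nth 0 m i)) *
                           \det (jt_mx h (size lam) m).
Proof.
rewrite /determinant; under [RHS]eq_bigr do rewrite big_distrr.
rewrite [RHS]exchange_big /=; apply: eq_bigr => s _.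
under eq_bigr do rewrite mxE.
rewrite (prod_sum_box (fun i x => c i x * hdiff h (x + s i)%N i)) big_distrr /=.
apply: eq_bigr => m _; rewrite big_split /= mulrCA; congr (_ * (_ * _)).
by apply: eq_bigr => i _; rewrite mxE.
Qed.

(* The row operation subtracting a suitable multiple of row i + 1 from row i
   truncates the geometric sums of an unprimed letter. *)
Lemma det_jt_rows b a h lam : is_partition lam ->
  \det (jt_mx (add_letter b a h) (size lam) lam) =
  \det (\matrix_(i < size lam, j < size lam)
     \sum_(x < (nth 0 lam i).+1)
       (if (if b then nth 0 lam i.+1 <= x else nth 0 lam i <= x.+1)%N
        then a ^+ (nth 0 lam i - x) else 0) * hdiff h (x + j)%N i).
Proof.
move=> plam; case: b; last first.
  (* For a primed letter no row operation is needed: only [x] equal to [nth 0 lam i] or one less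
     survives, and the latter exists because parts are positive. *)
  congr (\det _); apply/matrixP => i j; rewrite !mxE hdiff_add_letter.
  have := part_nth_gt0 i plam; rewrite ltn_ord.
  case: (nth 0 lam i) => // k _; rewrite !big_ord_recr /= big1 => [|x _]; last first.
    by rewrite ltnNge ltn_ord mul0r.
  by rewrite leqnn leqW // subnn subSnn expr0 expr1 mul1r add0r addSn hdiffSS addrC.
set M' := (X in _ = \det X); set h' := add_letter true a h.
pose c (i : nat) := a ^+ (nth 0 lam i - nth 0 lam i.+1).+1.
(* The geometric sum cut off at [y], with its remainder. It is applied with [y] the part [i + 1] and
   [y + k] the part [i]; the remainder is then a multiple of row [i + 1]. *)
have geom i j y k : hdiff h' (y + k + j) i =
    \sum_(x < (y + k).+1) (if (y <= x)%N then a ^+ (y + k - x) else 0) * hdiff h (x + j)%N i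
    + a ^+ k.+1 * hdiff h' (y + j) i.+1.
  elim: k => [|k IH].
    rewrite addn0 hdiff_add_letter big_ord_recr /= leqnn subnn expr0 mul1r expr1.
    rewrite big1 ?add0r // => x _; by rewrite leqNgt ltn_ord mul0r.
  rewrite addnS addSn hdiff_add_letter hdiffSS IH [in RHS]big_ord_recr /= leqW ?leq_addr //.
  rewrite subnn mul1r mulrDr mulrA -exprS addrA; congr (_ + _).
  rewrite addrC mulr_sumr; congr (_ + _); apply: eq_bigr => x _.
  case: leqP => _; last by rewrite !mul0r mulr0.
  by rewrite mulrA -exprS subSn // -ltnS ltn_ord.
pose U : 'M[K]_(size lam) := \matrix_(i, k) ((k == i)%:R - (k == i.+1 :> nat)%:R * c i).
have detU : \det U = 1.
  rewrite -det_tr det_trig; last first.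
    apply/is_trig_mxP => i j lt_ij; rewrite !mxE.
    have -> : (i == j) = false by apply: ltn_eqF.
    by rewrite (ltn_eqF (leqW lt_ij)) mul0r subr0.
  by rewrite big1 // => i _; rewrite !mxE eqxx (ltn_eqF (ltnSn i)) mul0r subr0.
suff -> : M' = U *m jt_mx h' (size lam) lam by rewrite det_mulmx detU mul1r.
apply/matrixP => i j; rewrite !mxE.
under [RHS]eq_bigr do rewrite !mxE mulrBl.
rewrite sumrB (bigD1 i) //= eqxx mul1r [X in _ = _ + X - _]big1 => [|k /negbTE ->];
  last by rewrite mul0r.
rewrite addr0.
(* In the last row nothing is subtracted, but the formula stays true: the index [j - i.+1] is
   negative there, so the term is 0. *)
have -> : \sum_(k < size lam) (k == i.+1 :> nat)%:R * c i * hdiff h' (nth 0 lam k + j) k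
          = c i * hdiff h' (nth 0 lam i.+1 + j)%N i.+1.
  have [hi|hi] := ltnP i.+1 (size lam).
    rewrite (bigD1 (Ordinal hi)) //= eqxx mul1r big1 ?addr0 // => k.
    by rewrite -val_eqE /= => /negbTE ->; rewrite !mul0r.
  rewrite nth_default // big1 => [|k _].
    by rewrite /hdiff add0n leqNgt (leq_trans (ltn_ord j)) ?mulr0 // ltnW.
  by rewrite (ltn_eqF (leq_trans (ltn_ord k) hi)) !mul0r.
have hle := part_nth_geq plam (leqnSn i).
have := geom i j (nth 0 lam i.+1) (nth 0 lam i - nth 0 lam i.+1)%N.
by rewrite subnKC // => ->; rewrite addrK.
Qed.

(** After expanding the rows, the sequences that are partitions give the branching terms; the
    remaining ones either have coefficient 0 or give a determinant with two equal rows. *)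
Lemma det_jt_letter b a h lam : is_partition lam ->
  \det (jt_mx (add_letter b a h) (size lam) lam) =
  \sum_(nu <- subpartitions lam | strip b nu lam)
     a ^+ (sumn lam - sumn nu) * \det (jt_mx h (size lam) nu).
Proof.
move=> plam; rewrite det_jt_rows //.
rewrite (det_sum_box h lam (fun i x => if (if b then nth 0 lam i.+1 <= x else nth 0 lam i <= x.+1)%N
        then a ^+ (nth 0 lam i - x) else 0)).
rewrite /subpartitions big_map big_filter_cond.
rewrite [RHS]big_mkcond big_seq [RHS]big_seq; apply: eq_bigr => m hm.
have [szm _] : size m = size lam /\ True by move: hm; rewrite mem_box_seqs => /andP[/eqP].
case: andP => [[sm /stripP hs]|hn].
  rewrite (eq_bigr (fun i : 'I_(size lam) => a ^+ (nth 0 lam i - nth 0 m i))).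
    rewrite prodrXr; congr (_ * _); [congr (_ ^+ _) | congr (\det _)].
      rewrite subshape_sumn ?filter_pos_part //; first by apply: eq_bigr => i _; rewrite nth_filter_pos.
      have : [seq x <- m | 0 < x]%N \in subpartitions lam.
        by apply/mapP; exists m; rewrite // mem_filter sm.
      exact: sub_subshape.
    by apply/matrixP => i j; rewrite !mxE nth_filter_pos.
  by move=> i _; have := hs i; rewrite nth_filter_pos // => ->.
case: (boolP (all (fun i => if b then nth 0 lam i.+1 <= nth 0 m i
     else nth 0 lam i <= (nth 0 m i).+1)%N (iota 0 (size lam)))) => [/allP hall|]; last first.
  case/allPn => i; rewrite mem_iota add0n => hi /negbTE hP.
  by rewrite (bigD1 (Ordinal hi)) //= hP !mul0r.
suff -> : \det (jt_mx h (size lam) m) = 0 by rewrite mulr0.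
have {}hall i : (i < size lam)%N -> (if b then nth 0 lam i.+1 <= nth 0 m i
     else nth 0 lam i <= (nth 0 m i).+1)%N by move=> hi; apply: hall; rewrite mem_iota.
have : ~~ sorted geq m.
  apply/negP => sm; apply: hn; split=> //; apply/stripP => i; rewrite nth_filter_pos //.
  have [hi|hi] := ltnP i (size lam); first exact: hall.
  by case: b {hall}; rewrite nth_default // leqW.
have mle i : (nth 0 m i <= nth 0 lam i)%N.
  have [hi|hi] := ltnP i (size m); last by rewrite nth_default.
  by move: hm; rewrite mem_box_seqs => /andP[_ /forallP/(_ (Ordinal hi))].
have [[i hi hlt]|hall2] : (exists2 i, (i.+1 < size m)%N & (nth 0 m i < nth 0 m i.+1)%N)
    \/ sorted geq m; last by rewrite hall2.
  case: (boolP (sorted geq m)) => [|ns]; [by right | left].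
  have : ~~ all (fun i => (i.+1 < size m)%N ==> (nth 0 m i.+1 <= nth 0 m i)%N) (iota 0 (size m)).
    apply: contra ns => /allP h1; apply/(sortedP 0%N) => i hi.
    by have := h1 i; rewrite mem_iota hi /= => -> //; apply: ltnW.
  by case/allPn => i _; rewrite negb_imply -ltnNge => /andP[]; exists i.
move=> _; rewrite szm in hi.
have h1 := hall i (ltnW hi); have h2 := mle i.+1.
have h3 := part_nth_geq plam (leqnSn i).
(* An ascent contradicts the bounds for an unprimed letter. For a primed one they leave only an
   ascent by 1, and then rows [i] and [i.+1] coincide. *)
have e : nth 0%N m i.+1 = (nth 0%N m i).+1 by case: b h1 {hall hn} => h1; lia.
apply: (@determinant_alternate _ _ _ (Ordinal (ltnW hi)) (Ordinal hi)).
  by rewrite -val_eqE /= neq_ltn ltnSn.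
by move=> j; rewrite !mxE /= e addSn hdiffSS.
Qed.

(** Both sides obey the same recursion in the number of letters. For the empty alphabet, a nonempty
    [lam] gives a zero first row. *)
Theorem jacobi_trudi sg (w : nat -> K) n R lam : is_partition lam ->
  (size lam <= R)%N -> branch sg w n [::] lam = \det (jt_mx (complete sg w n) R lam).
Proof.
elim: n R lam => [|n IH] R lam plam hR; rewrite det_jt_widen ?complete0 //=.
  case: lam plam {hR} => [|r lam] plam /=.
    by rewrite det_mx00.
  apply/esym; rewrite (expand_det_row _ ord0) big1 // => j _.
  rewrite mxE /= /hdiff leq0n subn0.
  have := part_nth_gt0 0 plam; rewrite /= addn_eq0 => h.
  by rewrite -leqn0 leqNgt h mul0r.
rewrite det_jt_letter // big_seq_cond [RHS]big_seq_cond; apply: eq_bigr => nu /andP[hnu _].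
have pnu := sub_part plam hnu.
by rewrite (IH (size lam)) //; apply: subshape_size => //; apply: sub_subshape hnu.
Qed.

End JacobiTrudi.

(** * Newton's identities *)

Section Newton.
Variable K : comNzRingType.
Implicit Types (h p : nat -> K) (a : K).

Definition newton h p : Prop := forall m,
  m.+1%:R * h m.+1 = \sum_(r < m.+1) p r.+1 * h (m - r)%N.

Definition newton_defect h p m : K :=
  m.+1%:R * h m.+1 - \sum_(r < m.+1) p r.+1 * h (m - r)%N.

Lemma newtonP h p : newton h p <-> forall m, newton_defect h p m = 0.
Proof.
split=> H m; first by rewrite /newton_defect H subrr.
by apply/eqP; rewrite -subr_eq0 -/(newton_defect h p m) H.
Qed.

Lemma add_letter_geom a h m :
  add_letter true a h m = \sum_(r < m.+1) a ^+ r * h (m - r)%N.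
Proof.
elim: m => [|m IH]; first by rewrite big_ord1 mul1r.
rewrite add_letterS IH [RHS]big_ord_recl mul1r subn0 mulr_sumr; congr (_ + _).
by apply: eq_bigr => r _; rewrite mulrA -exprS.
Qed.

(** In generating functions, the defect is multiplied by $1/(1-at)$. This is invertible, so Newton's
    identities hold before adding the letter iff they hold after. *)
Lemma newton_defect_letter a h h' p p' :
  h' = add_letter true a h -> (forall r, p' r.+1 = p r.+1 + a ^+ r.+1) ->
  newton_defect h' p' 0 = newton_defect h p 0 /\
  forall m, newton_defect h' p' m.+1 = newton_defect h p m.+1 + a * newton_defect h' p' m.
Proof.
move=> eh ep; rewrite /newton_defect !big_ord1 /= subnn; split.
  by rewrite ep eh /= mulrDl expr1 mul1r; ring.
move=> m; rewrite [in h' m.+2]eh add_letterS -eh.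
have -> : \sum_(r < m.+2) p' r.+1 * h' (m.+1 - r)%N =
    \sum_(r < m.+2) p r.+1 * h (m.+1 - r)%N + a * h' m.+1
    + a * \sum_(r < m.+1) p' r.+1 * h' (m - r)%N.
  have -> : a * h' m.+1 = \sum_(r < m.+2) a ^+ r.+1 * h (m.+1 - r)%N.
    rewrite eh add_letter_geom mulr_sumr.
    by apply: eq_bigr => r _; rewrite mulrA -exprS.
  rewrite -big_split /= big_ord_recr [X in _ = X + _]big_ord_recr /= mulr_sumr.
  rewrite subnn [in h' 0%N]eh /= addrAC -big_split /= ep mulrDl; congr (_ + _).
  apply: eq_bigr => r _; rewrite subSn -1?ltnS // {1}eh add_letterS -eh !ep; ring.
by rewrite -[m.+2]addn1 natrD; ring.
Qed.

Lemma newton_letter a h h' p p' :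
  h' = add_letter true a h -> (forall r, p' r.+1 = p r.+1 + a ^+ r.+1) ->
  newton h p <-> newton h' p'.
Proof.
move=> eh ep; have [d0 dS] := newton_defect_letter eh ep.
rewrite !newtonP; split=> H m.
  by elim: m => [|m IH]; [rewrite d0 | rewrite dS IH H mulr0 addr0].
case: m => [|m]; first by rewrite -d0.
by have := dS m; rewrite !H mulr0 addr0.
Qed.

(** A primed letter contributes $-(-w)^r$, as the logarithmic derivative of $1+wt$ dictates. *)
Definition psum (sg : nat -> bool) (w : nat -> K) n r : K :=
  \sum_(i < n) (if sg i then w i ^+ r else - (- w i) ^+ r).

Lemma newton_complete sg w n : newton (complete sg w n) (psum sg w n).
Proof.
elim: n => [|n IH].
  move=> m; rewrite /= mulr0 big1 // => r _.
  by rewrite /psum big_ord0 mul0r.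
case e : (sg n).
  apply: (proj1 (newton_letter (a := w n) _ _) IH) => [|r]; first by rewrite /= e.
  by rewrite /psum big_ord_recr /= e.
(* Adding the primed letter [w n] undoes adding an unprimed letter [- w n], so the equivalence is
   used backwards. *)
apply: (proj2 (newton_letter (a := - w n) _ _) IH) => [|r] /=.
  apply/funext => m; rewrite e; elim: m => [|m IHm] //.
  by rewrite !add_letterS -IHm /= mulNr addrK.
by rewrite /psum big_ord_recr /= e subrK.
Qed.

(** The generating functions of two concatenated alphabets multiply. *)
Lemma complete_concat sg sg' (w w' : nat -> K) n m k :
  (forall i, (i < n)%N -> sg i = sg' i /\ w i = w' i) ->
  complete sg w (n + m) k = \sum_(i < k.+1) complete sg' w' n i *
     complete (fun i => sg (n + i)%N) (fun i => w (n + i)%N) m (k - i)%N.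
Proof.
move=> e; elim: m k => [|m IH] k.
  rewrite addn0 big_ord_recr /= subnn mulr1 big1 => [|i _]; last first.
    by rewrite subn_eq0 leqNgt ltn_ord mulr0.
  rewrite add0r; elim: n e k => [|n IH] e k //=.
  have [-> ->] := e n (ltnSn n); congr (add_letter _ _ _ k).
  by apply/funext => j; apply: IH => i hi; apply: e; apply: ltnW.
rewrite addnS /=; move: (complete sg w (n + m)) IH => H.
set f := complete sg' w' n; set g := complete _ _ m => HE.
move: (sg _) (w _) => b a.
elim: k => [|k IH]; first by rewrite /= HE.
rewrite add_letterS HE big_ord_recr [RHS]big_ord_recr /= subnn /= addrAC; congr (_ + _).
have -> : (if b then add_letter b a H k else H k) =
    \sum_(i < k.+1) f i * (if b then add_letter b a g (k - i) else g (k - i)%N).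
  by case: b IH => // _; rewrite HE.
rewrite mulr_sumr -big_split; apply: eq_bigr => i _ /=.
by rewrite subSn -1?ltnS // add_letterS; ring.
Qed.

End Newton.

(** * Linear relations uniform in the alphabet *)

Lemma det_jt_expand (A : comAlgType rat) (h : nat -> A) R lam :
  \det (jt_mx h R lam) = \sum_(s : 'S_R) (-1) ^+ s *:
    \prod_(i < R) hdiff h (nth 0 lam i + s i)%N i.
Proof.
apply: eq_bigr => s _; under eq_bigr do rewrite mxE.
by case: (odd_perm s); rewrite ?expr0 ?expr1 ?scaleN1r ?scale1r ?mulN1r ?mul1r.
Qed.

(* Identities valid at every point e of a family of algebras; the coefficients
   do not depend on e. *)
Section UniformSpan.
Variables (E : Type) (K : E -> comAlgType rat).

Definition uspan (I : Type) (v : forall e, I -> K e) (F : forall e, K e) : Prop :=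
  exists t : seq (rat * I), forall e, F e = \sum_(x <- t) x.1 *: v e x.2.

Section Linear.
Variables (I : Type) (v : forall e, I -> K e).

Lemma uspan_ext F G : (forall e, F e = G e) -> uspan v F -> uspan v G.
Proof. by move=> e [t ht]; exists t => x; rewrite -e. Qed.

Lemma uspan0 : uspan v (fun=> 0).
Proof. by exists [::] => e; rewrite big_nil. Qed.

Lemma uspan_gen i : uspan v (fun e => v e i).
Proof. by exists [:: (1, i)] => e; rewrite big_seq1 scale1r. Qed.

Lemma uspanD F G : uspan v F -> uspan v G -> uspan v (fun e => F e + G e).
Proof.
by move=> [t ht] [t' ht']; exists (t ++ t') => e; rewrite big_cat ht ht'.
Qed.

Lemma uspanZ a F : uspan v F -> uspan v (fun e => a *: F e).
Proof.
move=> [t ht]; exists [seq (a * x.1, x.2) | x <- t] => e.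
by rewrite big_map ht scaler_sumr; apply: eq_bigr => x _; rewrite scalerA.
Qed.

Lemma uspan_sum (J : Type) (s : seq J) (P : pred J) (F : J -> forall e, K e) :
  (forall j, P j -> uspan v (F j)) -> uspan v (fun e => \sum_(j <- s | P j) F j e).
Proof.
move=> h; elim: s => [|j s IH].
  by apply: uspan_ext uspan0 => e; rewrite big_nil.
case Pj: (P j); last by apply: uspan_ext IH => e; rewrite big_cons Pj.
by apply: uspan_ext (uspanD (h j Pj) IH) => e; rewrite big_cons Pj.
Qed.

End Linear.

Lemma uspan_trans (I J : Type) (u : forall e, I -> K e) (v : forall e, J -> K e) F :
  (forall i, uspan v (fun e => u e i)) -> uspan u F -> uspan v F.
Proof.
move=> h [t ht]; apply: uspan_ext (uspan_sum t (P := xpredT) (F := fun x e => x.1 *: u e x.2) _).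
  by move=> e; rewrite ht.
by move=> x _; apply: uspanZ; apply: h.
Qed.

(** Coefficients of repeated indices are added up; linear independence and the definition of double
    symmetry both require duplicate-free lists. *)
Lemma uspan_uniq (I : eqType) (v : forall e, I -> K e) F : uspan v F ->
  exists (s : seq I) (c : I -> rat), uniq s /\
    forall e, F e = \sum_(i <- s) c i *: v e i.
Proof.
move=> [t ht]; exists (undup (map snd t)), (fun i => \sum_(x <- t | x.2 == i) x.1).
split=> [|e]; first exact: undup_uniq.
under eq_bigr => i _ do rewrite scaler_suml big_mkcond.
rewrite exchange_big ht /= big_seq [RHS]big_seq; apply: eq_bigr => x xt.
rewrite (bigD1_seq x.2) ?undup_uniq ?mem_undup ?map_f //= eqxx big1 ?addr0 //.
by move=> i; rewrite eq_sym => /negbTE ->.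
Qed.

Lemma uspan_of_sum (I : Type) (v : forall e, I -> K e) (s : seq I) (c : I -> rat) F :
  (forall e, F e = \sum_(i <- s) c i *: v e i) -> uspan v F.
Proof.
by move=> h; exists [seq (c i, i) | i <- s] => e; rewrite h big_map.
Qed.

Definition monomials (x : forall e, nat -> K e) e (al : seq nat) : K e :=
  \prod_(r <- al) x e r.

Section Monomials.
Variable x : forall e, nat -> K e.

Lemma uspan_mono1 : uspan (monomials x) (fun=> 1).
Proof. by apply: uspan_ext (uspan_gen _ [::]) => e; rewrite /monomials big_nil. Qed.

Lemma uspan_mono_var r : uspan (monomials x) (fun e => x e r).
Proof. by apply: uspan_ext (uspan_gen _ [:: r]) => e; rewrite /monomials big_seq1. Qed.

Lemma uspan_monoM F G : uspan (monomials x) F -> uspan (monomials x) G ->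
  uspan (monomials x) (fun e => F e * G e).
Proof.
move=> [t ht] [t' ht'].
apply: uspan_ext (uspan_sum t (P := xpredT) (F := fun y e =>
  \sum_(z <- t') (y.1 * z.1) *: monomials x e (y.2 ++ z.2)) _) => [e|y _].
  rewrite ht ht' mulr_suml; apply: eq_bigr => y _.
  rewrite mulr_sumr; apply: eq_bigr => z _.
  by rewrite /monomials big_cat -scalerAl -scalerAr scalerA.
by apply: uspan_sum => z _; apply: uspanZ; apply: uspan_gen.
Qed.

Lemma uspan_mono_sub (y : forall e, nat -> K e) al :
  (forall r, uspan (monomials x) (fun e => y e r)) ->
  uspan (monomials x) (fun e => monomials y e al).
Proof.
move=> h; elim: al => [|r al IH].
  by apply: uspan_ext uspan_mono1 => e; rewrite /monomials big_nil.
by apply: uspan_ext (uspan_monoM (h r) IH) => e; rewrite /monomials big_cons.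
Qed.

End Monomials.

Variables (h p : forall e, nat -> K e).
Hypothesis h0 : forall e, h e 0%N = 1.

Definition jt e (lam : intpart) : K e := \det (jt_mx (h e) (size lam) lam).

Definition pshift e r : K e := p e r.+1.

(** In the Leibniz expansion each product is an $h$-monomial, or 0 if an index is negative; which
    case occurs depends only on [lam] and the permutation, not on the alphabet. *)
Lemma uspan_jt lam : uspan (monomials h) (fun e => jt e lam).
Proof.
pose F (s : 'S_(size lam)) e := (-1) ^+ s *:
  \prod_(i < size lam) hdiff (h e) (nth 0 lam i + s i)%N i.
apply: uspan_ext (uspan_sum (index_enum _) (P := xpredT) (F := F) _) => [e|s _].
  by rewrite /jt det_jt_expand.
apply: uspanZ; case: (boolP [forall i : 'I_(size lam), i <= nth 0 lam i + s i]%N).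
  move=> /forallP hs.
  pose be := [seq (nth 0%N lam i + s i - i)%N | i : 'I_(size lam) <- enum 'I_(size lam)].
  apply: (uspan_ext _ (uspan_gen (monomials h) be)) => e.
  rewrite /monomials big_map big_enum /=.
  by apply: eq_bigr => i _; rewrite /hdiff hs.
case/forallPn => i hi; apply: uspan_ext (uspan0 _) => e.
by rewrite (bigD1 i) //= /hdiff (negbTE hi) mul0r.
Qed.

Hypothesis newt : forall e, newton (h e) (p e).

Lemma uspan_psum r : uspan (monomials h) (fun e => p e r.+1).
Proof.
elim/ltn_ind: r => r IH.
apply: uspan_ext (uspanD (uspanZ r.+1%:R (uspan_mono_var h r.+1))
  (uspanZ (-1) (uspan_sum (index_enum 'I_r) (P := xpredT)
     (F := fun (i : 'I_r) e => p e i.+1 * h e (r - i)%N) _))) => [e|i _].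
  have := newt e r; rewrite mulr_natl big_ord_recr /= subnn h0 mulr1 scaler_nat => ->.
  by rewrite scaleN1r addrAC subrr add0r.
by apply: uspan_monoM; [apply: IH | apply: uspan_mono_var].
Qed.

(** Newton's identity is solved for $h_{m+1}$ by dividing by $m+1$; this is where rational
    coefficients are needed. *)
Lemma uspan_complete m : uspan (monomials pshift) (fun e => h e m).
Proof.
elim/ltn_ind: m => -[|m] IH.
  by apply: uspan_ext (uspan_mono1 _) => e; rewrite h0.
apply: uspan_ext (uspanZ m.+1%:R^-1 (uspan_sum (index_enum 'I_m.+1) (P := xpredT)
     (F := fun (i : 'I_m.+1) e => p e i.+1 * h e (m - i)%N) _)) => [e|i _].
  by rewrite -newt mulr_natl -scaler_nat scalerA mulVf ?scale1r ?Num.Theory.pnatr_eq0.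
apply: uspan_monoM; first exact: (uspan_mono_var pshift i).
by apply: IH; rewrite ltnS leq_subr.
Qed.

(** With base [d.+1], one larger part outweighs up to [d] smaller ones. Subtracting 1 makes zero
    entries weightless, so deleting them changes nothing. *)
Definition hmeasure d (al : seq nat) : nat := \sum_(x <- al) (d.+1 ^ x - 1)%N.

Lemma hmeasure_bound d al : (hmeasure d al < d.+1 ^ sumn al)%N.
Proof.
rewrite /hmeasure; elim: al => [|x al IH]; first by rewrite big_nil.
rewrite big_cons /= expnD; set y := (\sum_(i <- al) _)%N in IH *.
have hx : (0 < d.+1 ^ x)%N by rewrite expn_gt0.
move: (d.+1 ^ x)%N (d.+1 ^ sumn al)%N hx IH => u v; nia.
Qed.

(** The least moved point cannot go down, since all smaller values are already taken by fixed
    points. *)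
Lemma first_moved n (s : 'S_n) : s != 1%g ->
  exists2 i : 'I_n, (i < s i)%N & forall j : 'I_n, (j < i)%N -> s j = j.
Proof.
move=> s1; have [k hk] : exists k : 'I_n, s k != k.
  apply/existsP; rewrite -negb_forall; apply: contra s1 => /forallP hs.
  by apply/eqP/permP => k; rewrite perm1; apply/eqP; move/negPn: (hs k).
case: (@arg_minnP _ k (fun j => s j != j) (fun j : 'I_n => val j) hk) => i hi imin.
have fix_lt (j : 'I_n) : (j < i)%N -> s j = j.
  by move=> hj; apply/eqP; apply: contraTT hj => /imin; rewrite -leqNgt.
exists i => //; rewrite ltn_neqAle eq_sym hi leqNgt; apply/negP => hlt.
by move/eqP: (fix_lt _ hlt) hi => /eqP/perm_inj ->; rewrite eqxx.
Qed.

(* Every nontrivial permutation increases this measure in the Jacobi-Trudi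
   determinant, so h_lam is S_lam plus h-monomials of larger measure. *)
Lemma hmeasure_perm d lam (s : 'S_(size lam)) : is_partition lam ->
  sumn lam = d -> s != 1%g -> (forall i : 'I_(size lam), i <= nth 0 lam i + s i)%N ->
  (hmeasure d lam <
   hmeasure d [seq (nth 0 lam i + s i - i)%N | i : 'I_(size lam) <- enum 'I_(size lam)])%N.
Proof.
move=> plam hd s1 hle; have [i0 hi0 hfix] := first_moved s1.
have hsz : (size lam <= d)%N.
  rewrite -hd; case/andP: plam => _ /allP; elim: (lam : seq nat) => //= x l IH hl.
  have hx : (0 < x)%N by apply: hl; rewrite inE eqxx.
  have : (size l <= sumn l)%N by apply: IH => y hy; apply: hl; rewrite inE hy orbT.
  lia.
rewrite /hmeasure (big_nth 0%N) big_mkord big_map big_enum /=.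
rewrite (bigID (fun i : 'I__ => i < i0)%N) [in ltnRHS](bigID (fun i : 'I__ => i < i0)%N) /=.
rewrite [X in (_ < X + _)%N](eq_bigr (fun i : 'I_(size lam) => d.+1 ^ nth 0 lam i - 1)%N); last first.
  by move=> i hi; rewrite hfix // addnK.
(* Rows before [i0] agree. From [i0] on there are at most [d] parts, none above [u]; the new entry
   at [i0], at least [u.+1], alone outweighs them all. *)
rewrite ltn_add2l [ltnRHS](bigD1 i0) ?ltnn //=; apply: leq_trans (leq_addr _ _).
set u := nth 0%N lam i0.
apply: (@leq_trans (size lam * (d.+1 ^ u - 1)).+1).
  rewrite ltnS; apply: (@leq_trans (\sum_(i < size lam | ~~ (i < i0)) (d.+1 ^ u - 1))%N).
    apply: leq_sum => i; rewrite -leqNgt => hi; apply: leq_sub2r.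
    by rewrite leq_pexp2l // part_nth_geq.
  by rewrite sum_nat_const leq_mul2r -[X in (_ <= X)%N]card_ord max_card orbT.
apply: (@leq_trans (d.+1 ^ u.+1 - 1)); last first.
  by apply: leq_sub2r; rewrite leq_pexp2l //; lia.
have hd0 : (0 < size lam)%N by apply: leq_ltn_trans (ltn_ord i0).
have : (0 < d.+1 ^ u)%N by rewrite expn_gt0.
by rewrite expnS; move: (d.+1 ^ u)%N => v; nia.
Qed.

(** The Jacobi-Trudi expansion is solved for the term of the identity permutation. The other terms
    have the same degree and larger measure, which [hmeasure_bound] bounds, so the induction is on
    the remaining gap. *)
Lemma uspan_monomials_jt al : uspan jt (fun e => monomials h e al).
Proof.
have [k] := ubnP ((sumn al).+1 ^ sumn al - hmeasure (sumn al) al).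
elim: k al => // k IH al hk.
(* Sorting and dropping the zeros keeps the monomial, since $h_0=1$, and turns the list into a
   partition. *)
pose lam0 := sort geq [seq x <- al | 0 < x]%N.
have plam : is_partition lam0.
  rewrite /is_partition sort_sorted; last by move=> x y; apply: leq_total.
  by rewrite all_sort filter_all.
have sumE (G : nat -> nat) : G 0%N = 0%N -> (\sum_(x <- al) G x = \sum_(x <- lam0) G x)%N.
  move=> G0; rewrite (perm_big _ (permEl (perm_sort _ _))) /= big_filter.
  by rewrite [RHS]big_mkcond; apply: eq_bigr => x _; case: x => [|x]; rewrite ?G0.
have sumn_lam : sumn lam0 = sumn al by rewrite !sumnE -sumE.
have meas_lam : hmeasure (sumn al) lam0 = hmeasure (sumn al) al.
  by rewrite /hmeasure -sumE.
have mono_lam e : monomials h e al = monomials h e lam0.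
  rewrite /monomials (perm_big _ (permEl (perm_sort _ _))) /= big_filter.
  rewrite [RHS]big_mkcond; apply: eq_bigr => x _.
  by case: ltnP => //; rewrite leqn0 => /eqP ->.
pose lam := IntPart plam.
pose F (s : 'S_(size lam0)) e : K e := (-1) ^+ s *:
  \prod_(i < size lam0) hdiff (h e) (nth 0 lam0 i + s i)%N i.
pose G e : K e := jt e lam + -1 *: \sum_(s : 'S_(size lam0) | s != 1%g) F s e.
apply: (@uspan_ext _ jt G) => [e|]; rewrite /G.
  have -> : jt e lam = \sum_s F s e by rewrite /jt det_jt_expand.
  rewrite (bigD1 (1%g : 'S_(size lam0))) //= scaleN1r addrK /F odd_perm1 expr0 scale1r mono_lam /monomials.
  rewrite (big_nth 0%N) big_mkord; apply: eq_bigr => i _.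
  by rewrite perm1 /hdiff leq_addl addnK.
apply: uspanD; first exact: uspan_gen.
apply: uspanZ; apply: uspan_sum => s s1.
apply: uspanZ; case: (boolP [forall i : 'I_(size lam0), i <= nth 0 lam0 i + s i]%N); last first.
  case/forallPn => i hi; apply: uspan_ext (uspan0 _) => e.
  by rewrite (bigD1 i) //= /hdiff (negbTE hi) mul0r.
move=> /forallP hs; set be := [seq (nth 0 lam0 i + s i - i)%N | i : 'I_(size lam0) <- enum 'I_(size lam0)].
apply: uspan_ext (IH be _) => [e|].
  rewrite /monomials big_map big_enum /=.
  by apply: eq_bigr => i _; rewrite /hdiff hs.
have sumn_be : sumn be = sumn al.
  rewrite -sumn_lam sumnE big_map big_enum /= sumnB // big_split /=.
  have -> : (\sum_(i < size lam0) s i = \sum_(i < size lam0) i)%N by rewrite [RHS](reindex_perm s).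
  by rewrite addnK -sumn_nth.
have := hmeasure_perm plam sumn_lam s1 hs; rewrite -/be meas_lam sumn_be => hlt.
have := hmeasure_bound (sumn al) be; rewrite sumn_be => hb.
lia.
Qed.

End UniformSpan.

(** * The three alphabets *)

Section CellPresentation.
Variables lam mu : seq nat.
Hypothesis plam : is_partition lam.

Lemma cell_presents : presents (@row_of lam mu) (@col_of lam mu) lam mu.
Proof.
split=> [c d [e1 e2]|i j].
  apply: val_inj; rewrite [LHS]surjective_pairing [RHS]surjective_pairing.
  by congr pair; apply: val_inj.
split=> [/andP[h1 h2]|[c [<- <-]]]; last by have := valP c.
have hi : (i < size lam)%N by rewrite -part_nth_gt0 //; apply: leq_ltn_trans h2.
have hj : (j < head 0%N lam)%N.
  by apply: leq_trans h2 _; rewrite -nth0; apply: part_nth_geq.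
have hc : in_skew (lam := lam) mu (Ordinal hi, Ordinal hj) by rewrite /in_skew /= h1.
by exists (Sub (Ordinal hi, Ordinal hj) hc).
Qed.

Lemma conj_part_partition : is_partition (conj_part lam).
Proof.
apply/andP; split.
  apply/(sortedP 0%N) => i _ /=; rewrite leqNgt; apply/negP => hlt.
  have := hlt; rewrite nth_conj_part // => /ltnW.
  by rewrite -nth_conj_part // ltnn.
apply/(all_nthP 0%N) => j; rewrite size_map size_iota => hj.
by rewrite nth_conj_part // nth0.
Qed.

End CellPresentation.

(** The coordinates are deliberately swapped: the cells of the conjugate shape serve as cells of
    [lam / mu]. *)
Lemma conj_cell_presents lam mu : is_partition lam -> is_partition mu ->
  presents (@col_of (conj_part lam) (conj_part mu))
           (@row_of (conj_part lam) (conj_part mu)) lam mu.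
Proof.
move=> plam pmu.
have [inj ex] := cell_presents (conj_part mu) (conj_part_partition plam).
split=> [c d [e1 e2]|i j]; first by apply: inj; rewrite e1 e2.
rewrite leqNgt -nth_conj_part // -leqNgt andbC -nth_conj_part // andbC.
by rewrite ex; split=> -[c [e1 e2]]; exists c.
Qed.

Section SchurBranch.
Variable n : nat.

Definition var (i : nat) : {mpoly rat[n]} := if insub i is Some j then 'X_j else 0.

Lemma var_ord (i : 'I_n) : var i = 'X_i.
Proof. by rewrite /var valK. Qed.

Lemma schur_branch (lam : seq nat) : is_partition lam ->
  schur lam n = branch (fun=> true) var n [::] lam.
Proof.
move=> plam; have pres := cell_presents [::] plam.
rewrite -(sum_signed_tab _ _ plam _ pres) // => [|i]; last by rewrite nth_nil.
apply: eq_big => [T|T _].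
  apply: eq_forallb => c; apply: eq_forallb => d; rewrite /signed_rule.
  rewrite /= implybT andbT implybF /left_of /above.
  by rewrite [(T c < T d)%N]ltn_neqAle [(T c <= T d)%N && _]andbC.
by apply: eq_bigr => c _; rewrite var_ord.
Qed.

(** Transposing turns the semistandard rule into the rule for primed letters: strict along rows,
    weak down columns. *)
Lemma conj_skew_schur_branch sg (lam mu : seq nat) :
  is_partition lam -> is_partition mu -> subshape mu lam ->
  (forall i, (i < n)%N -> sg i = false) ->
  skew_schur (conj_part lam) (conj_part mu) n = branch sg var n mu lam.
Proof.
move=> plam pmu hsub hsg; have pres := conj_cell_presents plam pmu.
rewrite -(sum_signed_tab _ _ plam pmu pres) //.
apply: eq_big => [T|T _].
  apply: eq_forallb => c; apply: eq_forallb => d; rewrite /signed_rule hsg //.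
  rewrite /= implybT andbT implybF /left_of /above [LHS]andbC.
  by rewrite [(T c < T d)%N]ltn_neqAle [(T c <= T d)%N && _]andbC.
by apply: eq_bigr => c _; rewrite var_ord.
Qed.

End SchurBranch.

Lemma hook_schur_branch (lam : seq nat) k l : is_partition lam ->
  hook_schur lam k l = branch (fun i => i < k)%N (@var (k + l)) (k + l) [::] lam.
Proof.
move=> plam; have pres := cell_presents [::] plam.
rewrite -(sum_signed_tab _ _ plam _ pres) // => [|i]; last by rewrite nth_nil.
apply: eq_big => [T|T _].
  apply: eq_forallb => c; apply: eq_forallb => d; rewrite /signed_rule.
  by rewrite -leqNgt.
by apply: eq_bigr => c _; rewrite var_ord.
Qed.

Definition dup_var n i : {mpoly rat[n]} := var n (if (i < n)%N then i else i - n)%N.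

(** The alphabet is cut in the middle: the unprimed half yields $S_\mu$, the primed copy the
    conjugate skew factor. *)
Lemma double_schur_branch (lam : seq nat) n : is_partition lam ->
  double_schur lam n = branch (fun i => i < n)%N (dup_var n) (n + n) [::] lam.
Proof.
move=> plam; rewrite /double_schur.
rewrite (@branch_concat _ _ _ (fun=> true) (var n)) // => [|i hi]; last first.
  by rewrite /dup_var hi.
rewrite (big_morph (fun f : polyfam => f n) (id1 := 0) (op1 := +%R)) //.
rewrite big_seq [RHS]big_seq; apply: eq_bigr => mu hmu.
have pmu := sub_part plam hmu; have hsub := sub_subshape plam hmu.
transitivity (schur mu n * skew_schur (conj_part lam) (conj_part mu) n) => //.
rewrite schur_branch //; congr (_ * _).
rewrite (@conj_skew_schur_branch _ (fun i => n + i < n)%N) //; last first.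
  by move=> i _; rewrite ltnNge leq_addr.
congr branch; apply/funext => i.
by rewrite /dup_var ltnNge leq_addr /= addKn.
Qed.

(** An alphabet together with the polynomial ring of its weights: the index type over which linear
    relations are uniform. *)
Record point := Point {
  nvars : nat;
  unprimed : nat -> bool;
  weight : nat -> {mpoly rat[nvars]};
  letters : nat }.

Definition ring_at (e : point) : comAlgType rat := {mpoly rat[nvars e]}.

Definition h_at e : nat -> ring_at e :=
  complete (unprimed e) (weight e) (letters e).
Definition p_at e : nat -> ring_at e :=
  psum (unprimed e) (weight e) (letters e).
Definition S_at e (lam : intpart) : ring_at e :=
  branch (unprimed e) (weight e) (letters e) [::] lam.

Lemma S_at_jt e lam : S_at e lam = jt h_at e lam.
Proof. by apply: jacobi_trudi => //; case: lam. Qed.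

Definition pmono := monomials (pshift p_at).

Lemma S_at_pmono lam : uspan pmono (fun e => S_at e lam).
Proof.
apply: uspan_ext (uspan_trans _ (uspan_jt h_at lam)) => [e|al].
  by rewrite S_at_jt.
apply: uspan_mono_sub => r; apply: uspan_complete => e; first exact: complete0.
exact: newton_complete.
Qed.

Lemma h_at_pmono r : uspan pmono (fun e => h_at e r).
Proof.
apply: uspan_complete => e; first exact: complete0.
exact: newton_complete.
Qed.

Lemma pmono_hmono al : uspan (monomials h_at) (fun e => pmono e al).
Proof.
apply: uspan_mono_sub => r; apply: uspan_psum => e; first exact: complete0.
exact: newton_complete.
Qed.

Lemma pmono_S_at al : uspan S_at (fun e => pmono e al).
Proof.
apply: uspan_trans (pmono_hmono al) => be.
have [t ht] := @uspan_monomials_jt _ _ h_at (fun e => complete0 _ _ _) be.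
by exists t => e; rewrite ht; apply: eq_bigr => x _; rewrite S_at_jt.
Qed.

Definition plain n := Point (fun=> true) (var n) n.
Definition hooked k l := Point (fun i => i < k)%N (var (k + l)) (k + l).
Definition doubled n := Point (fun i => i < n)%N (dup_var n) (n + n).

(** * Doubly symmetric functions and odd power sums *)

Lemma polyfam_sumE (I : Type) (s : seq I) (P : pred I) (F : I -> polyfam) n :
  (\sum_(i <- s | P i) F i) n = \sum_(i <- s | P i) F i n.
Proof. by rewrite (big_morph (fun f : polyfam => f n) (id1 := 0) (op1 := +%R)). Qed.

Lemma polyfam_prodE (I : Type) (s : seq I) (P : pred I) (F : I -> polyfam) n :
  (\prod_(i <- s | P i) F i) n = \prod_(i <- s | P i) F i n.
Proof. by rewrite (big_morph (fun f : polyfam => f n) (id1 := 1) (op1 := *%R)). Qed.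

Lemma intpart_of_seq (al : seq nat) : all (leq 1) al ->
  exists lam : intpart, perm_eq lam al.
Proof.
move=> hal; have plam : is_partition (sort geq al).
  by rewrite /is_partition sort_sorted ?all_sort // => x y; apply: leq_total.
by exists (IntPart plam); rewrite /= (permEl (perm_sort _ _)).
Qed.

Lemma intpartP (lam : intpart) : is_partition lam.
Proof. by case: lam. Qed.

Lemma perm_intpart (lam mu : intpart) : perm_eq lam mu -> lam = mu.
Proof.
move=> e; apply: val_inj; apply: (sorted_eq (leT := geq)) e.
- exact: rev_trans leq_trans.
- by move=> x y /andP[h1 h2]; apply/eqP; rewrite eqn_leq; apply/andP.
- exact: part_sorted (intpartP lam).
- exact: part_sorted (intpartP mu).
Qed.

Definition psum_part e (lam : intpart) : ring_at e := \prod_(r <- parts lam) p_at e r.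

Lemma uspan_psum_part F : uspan pmono F -> uspan psum_part F.
Proof.
apply: uspan_trans => al.
have [|lam hlam] := @intpart_of_seq (map S al); first by rewrite all_map; apply/allP.
apply: uspan_ext (uspan_gen psum_part lam) => e.
by rewrite /psum_part (perm_big _ hlam) big_map.
Qed.

Lemma psum_part_pmono e (lam : intpart) : psum_part e lam = pmono e (map predn lam).
Proof.
rewrite /pmono /monomials big_map /psum_part big_seq [RHS]big_seq.
apply: eq_bigr => r hr; rewrite /pshift prednK //.
by have /andP[_ /allP] := intpartP lam; apply.
Qed.

Lemma psum_part_S_at lam : uspan S_at (fun e => psum_part e lam).
Proof.
by apply: uspan_ext (pmono_S_at (map predn lam)) => e; rewrite psum_part_pmono.
Qed.

Lemma S_at_plain n lam : S_at (plain n) lam = schur lam n.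
Proof. by rewrite schur_branch // intpartP. Qed.

Lemma S_at_hooked k l lam : S_at (hooked k l) lam = hook_schur lam k l.
Proof. by rewrite hook_schur_branch // intpartP. Qed.

Lemma S_at_doubled n lam : S_at (doubled n) lam = double_schur lam n.
Proof. by rewrite double_schur_branch // intpartP. Qed.

Lemma p_at_plain n r : p_at (plain n) r = powersum r n.
Proof. by apply: eq_bigr => i _; rewrite /= var_ord. Qed.

Lemma psum_part_plain n lam : psum_part (plain n) lam = powersum_part lam n.
Proof.
by rewrite /powersum_part polyfam_prodE; apply: eq_bigr => r _; rewrite p_at_plain.
Qed.

(** For odd [r] the primed contribution $-(-y)^r$ is $y^r$, so the prime is invisible. *)
Lemma p_at_hooked k l r : odd r -> p_at (hooked k l) r = powersum r (k + l)%N.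
Proof.
move=> hr; apply: eq_bigr => i _ /=; rewrite var_ord.
by rewrite exprNn -signr_odd hr expr1 mulN1r opprK if_same.
Qed.

(** The primed copy contributes $-(-1)^r p_r$, which cancels or doubles the unprimed half. *)
Lemma p_at_doubled n r :
  p_at (doubled n) r = (if odd r then 2 else 0) *: powersum r n.
Proof.
transitivity (powersum r n + - (-1) ^+ r * powersum r n : {mpoly rat[n]}).
  rewrite /p_at /psum [LHS]big_split_ord; congr (_ + _).
    by apply: eq_bigr => i _; rewrite /= /dup_var ltn_ord var_ord.
  rewrite mulr_sumr; apply: eq_bigr => i _ /=.
  by rewrite /dup_var ltnNge leq_addr /= addKn [in LHS]exprNn mulNr var_ord.
rewrite -signr_odd; case: (odd r); last by rewrite expr0 mulN1r subrr scale0r.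
by rewrite expr1 opprK mul1r scaler_nat mulr2n.
Qed.

Lemma psum_part_hooked k l (lam : intpart) : odd_partition lam ->
  psum_part (hooked k l) lam = powersum_part lam (k + l)%N.
Proof.
move=> /allP hlam; rewrite -psum_part_plain /psum_part big_seq [RHS]big_seq.
by apply: eq_bigr => r hr; rewrite p_at_hooked ?p_at_plain // hlam.
Qed.

Lemma psum_part_doubled n (lam : intpart) : psum_part (doubled n) lam =
  (if odd_partition lam then 2 ^+ size lam else 0) *: powersum_part lam n.
Proof.
rewrite -psum_part_plain /psum_part /odd_partition.
elim: (parts lam) => [|r al IH]; first by rewrite !big_nil scale1r.
rewrite !big_cons IH p_at_doubled p_at_plain -scalerAl -scalerAr scalerA /=.
by case: (odd r); case: (all odd al); rewrite ?mulr0 ?mul0r // -exprS.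
Qed.

(** * Setting the two sets of variables equal *)

Definition fold_vars n (q : {mpoly rat[n + n]}) : {mpoly rat[n]} :=
  q \mPo [tuple dup_var n i | i < n + n].

Lemma fold_vars_lin n (I : Type) (s : seq I) (c : I -> rat) F :
  @fold_vars n (\sum_(i <- s) c i *: F i) = \sum_(i <- s) c i *: fold_vars (F i).
Proof.
rewrite /fold_vars; elim: s => [|i s IH]; first by rewrite !big_nil comp_mpoly0.
by rewrite !big_cons comp_mpolyD comp_mpolyZ IH.
Qed.

Lemma fold_vars_var n (i : 'I_(n + n)) :
  var (n + n) i \mPo [tuple dup_var n i | i < n + n] = dup_var n i.
Proof. by rewrite var_ord comp_mpolyXU -tnth_nth tnth_mktuple. Qed.

Lemma fold_psum_part_hooked n lam :
  fold_vars (psum_part (hooked n n) lam) = psum_part (doubled n) lam.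
Proof.
rewrite /fold_vars rmorph_prod; apply: eq_bigr => r _.
rewrite rmorph_sum; apply: eq_bigr => i _ /=.
by case: ltnP => _; rewrite ?rmorphN rmorphXn ?rmorphN /= fold_vars_var.
Qed.

Lemma fold_psum_part_plain n (lam : intpart) :
  fold_vars (psum_part (plain (n + n)) lam) = 2 ^+ size lam *: powersum_part lam n.
Proof.
rewrite -psum_part_plain /fold_vars rmorph_prod /= /psum_part.
elim: (parts lam) => [|r al IH]; first by rewrite !big_nil scale1r.
rewrite !big_cons IH p_at_plain /=.
suff -> : powersum r (n + n)%N \mPo [tuple dup_var n i | i < n + n] = 2 *: p_at (plain n) r.
  by rewrite -scalerAl -scalerAr scalerA -exprS.
rewrite rmorph_sum [LHS]big_split_ord scaler_nat mulr2n.
by congr (_ + _); apply: eq_bigr => i _; rewrite rmorphXn /= -var_ord fold_vars_var /dup_var /=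
  ?ltn_ord // ltnNge leq_addr /= addKn.
Qed.

(* If x^lam occurs in p_mu then every variable is hit by some part of mu; with
   no more parts than variables, each variable is hit exactly once. *)
Lemma powersum_part_coeff (lam mu : intpart) : (size mu <= size lam)%N ->
  ((powersum_part mu (size lam))@_[multinom nth 0%N lam i | i < size lam] != 0)
    = (mu == lam).
Proof.
move=> hsz; set n := size lam; set m := [multinom _ | i < n].
pose mon (g : {ffun 'I_(size mu) -> 'I_n}) :=
  (\sum_(j < size mu) U_(g j) *+ nth 0%N mu j)%MM.
have -> : powersum_part mu n = \sum_(g : {ffun 'I_(size mu) -> 'I_n}) 'X_[mon g].
  rewrite /powersum_part polyfam_prodE (big_nth 0%N) big_mkord.
  rewrite bigA_distr_bigA; apply: eq_bigr => g _.
  rewrite /mon (big_morph _ (@mpolyXD _ _) (@mpolyX0 _ _)).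
  by apply: eq_bigr => j _; rewrite mpolyXn.
have -> : (\sum_(g : {ffun 'I_(size mu) -> 'I_n}) 'X_[mon g])@_m =
    #|[pred g | mon g == m]|%:R :> rat.
  rewrite raddf_sum /= (eq_bigr (fun g => if mon g == m then 1 else 0)) => [|g _].
    by rewrite -big_mkcond sumr_const.
  by rewrite mcoeffX; case: ifP.
rewrite Num.Theory.pnatr_eq0 -lt0n; apply/card_gt0P/eqP => [[g]|e].
  rewrite inE => /eqP/mnmP hg.
  have hgi i : (\sum_(j < size mu) (g j == i) * nth 0 mu j)%N = nth 0%N lam i.
    have := hg i; rewrite mnmE mnm_sumE => <-.
    by apply: eq_bigr => j _; rewrite mulmnE mnm1E.
  have surj i : i \in codom g.
    apply: contraT => hi; have := hgi i; rewrite big1 => [h|j _].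
      by have := part_nth_gt0 i (intpartP lam); rewrite ltn_ord -h.
    case: eqP => // e; case/negP: hi; rewrite -e; exact: codom_f.
  have hcard : #|codom g| = n by rewrite (eq_card surj) card_ord.
  have ginj : injective g.
    have /image_injP hin : #|image g 'I_(size mu)| == #|'I_(size mu)|.
      rewrite [X in X == _]hcard card_ord eqn_leq hsz andbT.
      by have := card_size (codom g); rewrite hcard size_codom card_ord.
    by move=> j k; apply: hin.
  have gval j : nth 0%N lam (g j) = nth 0%N mu j.
    rewrite -hgi (bigD1 j) //= eqxx mul1n big1 ?addn0 // => k hk.
    by rewrite (inj_eq ginj) (negbTE hk).
  apply: perm_intpart.
  rewrite -(mkseq_nth 0%N mu) -(mkseq_nth 0%N lam) /mkseq -!val_enum_ord -!map_comp.
  rewrite (eq_map (g := (fun i : 'I_n => nth 0%N lam i) \o g)) => [|j /=]; last by rewrite gval.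
  rewrite map_comp -!enumT; apply: perm_map; apply: uniq_perm; rewrite ?enum_uniq //.
    by rewrite map_inj_uniq ?enum_uniq.
  by move=> i; rewrite mem_enum; have := surj i.
subst mu; exists [ffun j => j]; rewrite inE; apply/eqP/mnmP => i.
rewrite mnmE mnm_sumE (bigD1 i) //= mulmnE mnm1E ffunE eqxx.
rewrite mul1n big1 ?addn0 // => j hj; rewrite mulmnE mnm1E ffunE.
by rewrite (negbTE hj).
Qed.

(** Among the partitions with nonzero coefficient, one with the most parts is chosen; in as many
    variables as it has parts, its own monomial occurs in no other term. *)
Lemma powersum_part_indep : lin_indep (fun lam : intpart => powersum_part lam).
Proof.
move=> s c us hsum i is_; apply/eqP; apply: contraT => ci.
have [lam [ls cl lmax]] : exists lam, [/\ lam \in s, c lam != 0 &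
    forall mu, mu \in s -> c mu != 0 -> (size mu <= size lam)%N].
  have hex : exists k, has (fun lam : intpart => (c lam != 0) && (size lam == k)) s.
    by exists (size i); apply/hasP; exists i; rewrite // ci eqxx.
  have hub k : has (fun lam : intpart => (c lam != 0) && (size lam == k)) s ->
      (k <= \max_(lam <- s) size (parts lam))%N.
    by case/hasP => lam hl /andP[_ /eqP <-]; apply: leq_bigmax_seq.
  case: (ex_maxnP hex hub) => k /hasP[lam hl /andP[cl /eqP hk]] kmax.
  exists lam; split=> // mu hm cm; rewrite hk; apply: kmax.
  by apply/hasP; exists mu; rewrite // cm eqxx.
set n := size (parts lam); set m := [multinom nth 0%N lam i | i < n].
have : (\sum_(mu <- s) c mu *: powersum_part mu n)@_m = 0.
  rewrite -(polyfam_sumE s xpredT (fun mu : intpart => c mu *: powersum_part mu)).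
  by rewrite hsum; apply: mcoeff0.
rewrite raddf_sum /= (bigD1_seq lam) //= big1_seq ?addr0 => [|mu /andP[ne hm]].
  move/eqP; rewrite mcoeffZ mulf_eq0 (negbTE cl) /= => h0.
  by have := powersum_part_coeff (leqnn (size lam)); rewrite -/n -/m h0 eqxx.
rewrite mcoeffZ; have [->|cm] := eqVneq (c mu) 0; first by rewrite mul0r.
have := powersum_part_coeff (lmax mu hm cm); rewrite (negbTE ne) => /negbFE/eqP.
by rewrite -/n -/m => ->; rewrite mulr0.
Qed.

Lemma symfun_subalgebra : subalgebra symfun.
Proof.
split=> [|a f g [sf df [d hd]] [sg dg [d' hd']]|f g [sf df [d hd]] [sg dg [d' hd']]].
- split=> [n|n|]; first exact: rpred1.
    exact: comp_mpoly1.
  by exists 1%N => n; rewrite msize1.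
- split=> [n|n|]; first exact: (rpredD (rpredZ a (sf n)) (sg n)).
    rewrite [RHS]/(a *: f n + g n) -df -dg /drop_var.
    by rewrite [X in X \mPo _]/(a *: f n.+1 + g n.+1) comp_mpolyD comp_mpolyZ.
  exists (maxn d d') => n; apply: leq_trans (msizeD_le _ _) _.
  by rewrite geq_max !leq_max (leq_trans (msizeZ_le _ _) (hd n)) hd' orbT.
- split=> [n|n|]; first by rewrite [X in X \is _]/(f n * g n); apply: rpredM; [apply: sf | apply: sg].
    by rewrite [RHS]/(f n * g n) -df -dg; apply: rmorphM.
  exists (d + d').+1 => n; apply: leq_trans (msizeM_le _ _) _.
  by rewrite ltnS leq_add.
Qed.

(** Positivity matters for stability: $p_0$ would be the number of variables. *)
Lemma symfun_powersum r : (0 < r)%N -> symfun (powersum r).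
Proof.
move=> hr; split=> [n|n|].
- apply/issymP => s; rewrite /powersum rmorph_sum /= [RHS](reindex_perm s).
  by apply: eq_bigr => i _; rewrite rmorphXn /= /msym mmapX mmap1U.
- rewrite /powersum /drop_var rmorph_sum big_ord_recr /= rmorphXn /= comp_mpolyXU.
  rewrite -tnth_nth tnth_mktuple unlift_none expr0n eqn0Ngt hr addr0.
  apply: eq_bigr => i _; rewrite rmorphXn /= comp_mpolyXU -tnth_nth tnth_mktuple.
  have -> : widen_ord (leqnSn n) i = lift ord_max i by apply: ord_inj; rewrite lift_max.
  by rewrite liftK.
exists r.+1 => n; apply: leq_trans (msize_sum _ _ _) _.
apply/bigmax_leqP_seq => i _ _; rewrite mpolyXn msizeX.
by rewrite mdegMn mdeg1 mul1n.
Qed.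

Definition oddpart := {lam : intpart | odd_partition lam}.

(** The uniform span over a one-point family, so that the lemmas on [uspan] apply to [polyfam] as
    well. *)
Definition in_span (I : Type) (v : I -> polyfam) (f : polyfam) : Prop :=
  uspan (K := fun _ : unit => polyfam) (fun _ => v) (fun _ => f).

Lemma in_span_gen (I : Type) (v : I -> polyfam) i : in_span v (v i).
Proof. exact: (@uspan_gen unit (fun=> polyfam) _ (fun=> v)). Qed.

Lemma in_span0 (I : Type) (v : I -> polyfam) : in_span v 0.
Proof. exact: (@uspan0 unit (fun=> polyfam)). Qed.

Lemma in_spanZ (I : Type) (v : I -> polyfam) a f :
  in_span v f -> in_span v (a *: f).
Proof. exact: (@uspanZ unit (fun=> polyfam)). Qed.

Lemma in_span_unscale (I : Type) (v : I -> polyfam) a f : a != 0 ->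
  in_span v (a *: f) -> in_span v f.
Proof. by move=> a0 /(in_spanZ a^-1); rewrite scalerA mulVf // scale1r. Qed.

Lemma in_span_trans (I J : Type) (u : I -> polyfam) (v : J -> polyfam) f :
  (forall i, in_span v (u i)) -> in_span u f -> in_span v f.
Proof. exact: (@uspan_trans unit (fun=> polyfam)). Qed.

Lemma in_spanP (I : eqType) (v : I -> polyfam) f : in_span v f <->
  exists (s : seq I) (c : I -> rat), f = \sum_(i <- s) c i *: v i.
Proof.
split=> [/uspan_uniq [s [c [_ h]]]|[s [c h]]]; first by exists s, c; apply: (h tt).
by apply: (uspan_of_sum (s := s) (c := c)).
Qed.

Lemma doubly_symmetric_span f :
  doubly_symmetric f -> in_span (fun lam : oddpart => powersum_part (val lam)) f.
Proof.
move=> [_ [s [c [_ ef hf]]]].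
(* One expression for both sides of the definition: it gives [f] at plain alphabets and the hook
   Schur sum at hooked ones. *)
pose F e : ring_at e := \sum_(lam <- s) c lam *: S_at e lam.
have : uspan psum_part F.
  apply: uspan_psum_part; apply: uspan_sum => lam _; apply: uspanZ; exact: S_at_pmono.
case/uspan_uniq => t [a [ut ht]].
have fE : f = \sum_(i <- t) a i *: powersum_part i.
  apply: polyfamP => n; rewrite polyfam_sumE.
  transitivity (F (plain n)).
    by rewrite ef polyfam_sumE; apply: eq_bigr => lam _; rewrite S_at_plain.
  by rewrite ht; apply: eq_bigr => i _; rewrite psum_part_plain.
have hF n : F (plain (n + n)) = F (hooked n n).
  transitivity (\sum_(lam <- s) c lam *: schur lam (n + n)%N).
    by apply: eq_bigr => lam _; rewrite S_at_plain.
  by rewrite hf; apply: eq_bigr => lam _; rewrite S_at_hooked.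
have a0 i : i \in t -> ~~ odd_partition i -> a i = 0.
  (* [b] collects the coefficients of the difference of the two foldings: $2^{\ell}-2^{\ell}$ for
     odd partitions of length $\ell$, $2^{\ell}-0$ for the others. *)
  move=> it ni; pose b i := a i * ((if odd_partition i then 0 else 1) * 2 ^+ size (parts i)).
  suff : b i = 0.
    rewrite /b (negbTE ni) mul1r => /eqP; rewrite mulf_eq0 expf_eq0.
    by rewrite Num.Theory.pnatr_eq0 andbF orbF => /eqP.
  apply: (powersum_part_indep ut) it; apply: polyfamP => n; rewrite polyfam_sumE.
  have : fold_vars (F (plain (n + n))) - fold_vars (F (hooked n n)) = 0.
    by rewrite hF subrr.
  rewrite !ht !fold_vars_lin -sumrB => H; apply: etrans H; apply: eq_bigr => j _.
  rewrite [LHS]/(b j *: powersum_part j n).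
  rewrite fold_psum_part_hooked fold_psum_part_plain psum_part_doubled.
  rewrite !scalerA -scalerBl /b; congr (_ *: _).
  by case: ifP; rewrite ?mul0r ?mul1r ?mulr0 ?subrr ?subr0.
rewrite fE (bigID (fun i => odd_partition i)) /= [X in _ + X]big1_seq ?addr0.
  apply: (@uspan_sum unit (fun=> polyfam) _ _ _ t _
    (fun i _ => a i *: powersum_part (parts i))) => i hi.
  apply: in_spanZ.
  exact: (in_span_gen (fun lam : oddpart => powersum_part (val lam)) (exist _ i hi)).
by move=> i /andP[hi it]; rewrite a0 // scale0r.
Qed.

(** Odd power sum products are written in Schur functions uniformly in the alphabet; these
    coefficients witness double symmetry, because odd power sums agree at [plain (k + l)] and
    [hooked k l]. *)
Lemma span_doubly_symmetric f :
  in_span (fun lam : oddpart => powersum_part (val lam)) f -> doubly_symmetric f.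
Proof.
move=> [t /(_ tt) ef].
pose F e : ring_at e := \sum_(x <- t) x.1 *: psum_part e (val x.2).
have : uspan S_at F.
  by apply: uspan_sum => x _; apply: uspanZ; apply: psum_part_S_at.
case/uspan_uniq => s [c [us hs]].
have fE n : f n = F (plain n).
  by rewrite ef polyfam_sumE; apply: eq_bigr => x _; rewrite psum_part_plain.
split.
  rewrite ef; have [s1 sL sM] := symfun_subalgebra.
  have s0 : symfun 0 by have := sL (-1) 1 1 s1 s1; rewrite scaleN1r addNr.
  elim/big_ind: _ => // [x y hx hy|x _]; first by have := sL 1 x y hx hy; rewrite scale1r.
  rewrite -[_ *: _]addr0; apply: sL => //; rewrite /powersum_part.
  have := valP x.2; rewrite /odd_partition; elim: (parts _) => [|r al IH] /=.
    by rewrite big_nil.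
  case/andP=> hr hal; rewrite big_cons; apply: sM; last exact: IH.
  by apply: symfun_powersum; case: r hr.
exists s, c; split=> //.
  apply: polyfamP => n; rewrite fE hs polyfam_sumE.
  by apply: eq_bigr => lam _; rewrite S_at_plain.
move=> k l; transitivity (F (plain (k + l))).
  by rewrite hs; apply: eq_bigr => lam _; rewrite S_at_plain.
transitivity (F (hooked k l)); last first.
  by rewrite hs; apply: eq_bigr => lam _; rewrite S_at_hooked.
apply: eq_bigr => x _; rewrite psum_part_plain psum_part_hooked //.
exact: (valP x.2).
Qed.

Lemma doubly_symmetricP f : doubly_symmetric f <->
  in_span (fun lam : oddpart => powersum_part (val lam)) f.
Proof. by split; [apply: doubly_symmetric_span | apply: span_doubly_symmetric]. Qed.

(** * Sums of hooks *)

Section Hooks.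
Variable K : comNzRingType.
Variable h : nat -> K.
Hypothesis h0 : h 0%N = 1.

Definition hook_det a b : K := \det (jt_mx h b.+1 (a :: nseq b 1%N)).
Definition column_det b : K := \det (jt_mx h b (nseq b 1%N)).

(** Pieri's rule for $h_a e_{b+1}$. The first column of the hook determinant has only two nonzero
    entries, $h_a$ and $h_0=1$; their minors are a column and a shorter hook. *)
Lemma hook_detS a b :
  h a * column_det b.+1 = hook_det a b.+1 + hook_det a.+1 b.
Proof.
rewrite {1}/hook_det (expand_det_col _ ord0) 2!big_ord_recl big1 ?addr0.
  rewrite !mxE /= /hdiff /= !addn0 subn0 subnn h0 mul1r /cofactor /= addn0 expr0 mul1r.
  have -> : row' ord0 (col' ord0 (jt_mx h b.+2 [:: a, 1%N & nseq b 1%N])) =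
    jt_mx h b.+1 (nseq b.+1 1%N).
    by apply/matrixP => i j; rewrite !mxE !lift0 addnS hdiffSS.
  have -> : row' (lift ord0 ord0) (col' ord0 (jt_mx h b.+2 [:: a, 1%N & nseq b 1%N])) =
    jt_mx h b.+1 (a.+1 :: nseq b 1%N).
    apply/matrixP => i j; rewrite !mxE lift0.
    case: (unliftP ord0 i) => [k ->|->]; last by rewrite /= addnS.
    have -> : lift (lift ord0 ord0) (lift ord0 k) = k.+2 :> nat by [].
    by rewrite lift0 /= addnS hdiffSS.
  by rewrite expr1 mulN1r subrK.
move=> i _; rewrite !mxE !lift0 /= nth_nseq; case: ifP => _;
  by rewrite /hdiff !addn0 ?mul0r.
Qed.

(** By Pieri's rule each inner term is a sum of two neighbouring hooks, and the end terms $e_{k+1}$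
    and $h_{k+1}$ are themselves hooks; every hook thus appears twice. *)
Lemma hook_det_sum k : \sum_(i < k.+2) h i * column_det (k.+1 - i)%N =
  2 * \sum_(i < k.+1) hook_det i.+1 (k - i)%N.
Proof.
have hd0 a : hook_det a 0 = h a.
  by rewrite /hook_det det_mx11 mxE /= /hdiff addn0 subn0.
have c0 : column_det 0 = 1 by rewrite /column_det det_mx00.
rewrite big_ord_recl h0 mul1r subn0 big_ord_recr /= /bump /= add1n subSS subnn c0 mulr1.
rewrite (eq_bigr (fun i : 'I_k => hook_det i.+1 (k - i)%N + hook_det i.+2 (k - i.+1)%N)) => [|i _].
  rewrite big_split /= mulr2n mulrDl !mul1r.
  rewrite [X in _ = X + _]big_ord_recr [X in _ = _ + X]big_ord_recl /= subnn subn0 hd0.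
  by rewrite -[column_det k.+1]/(hook_det 1 k); ring.
have e : (k - i = (k - i.+1).+1)%N by have := ltn_ord i; lia.
by rewrite /bump /= add1n subSS e hook_detS.
Qed.

End Hooks.

(** For primed letters $h_b$ is $e_b$: the Schur function of one row, transposed to a column and
    expanded by Jacobi-Trudi again. *)
Lemma complete_primed n b :
  complete (fun=> false) (var n) n b = column_det (h_at (plain n)) b.
Proof.
case: b => [|b]; first by rewrite complete0 /column_det det_mx00.
have p1 : is_partition [:: b.+1] by [].
have pc : is_partition (nseq b.+1 1%N).
  by rewrite /is_partition all_nseq orbT andbT; elim: b {p1} => [|b IH].
have cE : conj_part [:: b.+1] = nseq b.+1 1%N.
  apply: (@eq_from_nth _ 0%N); first by rewrite size_map size_iota size_nseq.
  move=> i; rewrite size_map size_iota => hi.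
  by rewrite (nth_map 0%N) ?size_iota // nth_iota // nth_nseq hi /= hi.
have := @jacobi_trudi _ (fun=> false) (var n) n 1 _ p1 isT.
rewrite det_mx11 mxE /hdiff /= addn0 subn0 => <-.
rewrite -(@conj_skew_schur_branch n (fun=> false) _ [::] p1) // => [|i]; last first.
  by rewrite nth_nil.
rewrite cE.
rewrite -[skew_schur _ _ n]/(schur (nseq b.+1 1%N) n) schur_branch //.
by rewrite (@jacobi_trudi _ _ _ _ b.+1) ?size_nseq.
Qed.

Lemma complete_doubled n m :
  h_at (doubled n) m.+1 = 2 *: hook_sum m.+1 n.
Proof.
rewrite /h_at /= (@complete_concat _ _ (fun=> true) _ (var n)) => [|i hi]; last first.
  by rewrite /dup_var hi.
have -> : complete (fun i => n + i < n)%N (fun i => dup_var n (n + i)) n =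
    column_det (h_at (plain n)).
  apply/funext => b; rewrite -complete_primed; congr complete; apply/funext => i.
    by rewrite ltnNge leq_addr.
  by rewrite /dup_var ltnNge leq_addr /= addKn.
have := hook_det_sum (complete0 _ _ _ : h_at (plain n) 0%N = 1) m.
rewrite /h_at /= => ->; rewrite scaler_nat mulr_natl; congr (_ *+ 2).
rewrite /hook_sum polyfam_sumE.
rewrite -(pair_big_dep xpredT (fun a b : 'I_m.+2 => ((a + b == m.+1) && (1 <= a))%N)
  (fun a b : 'I_m.+2 => schur ((a : nat) :: nseq b 1%N) n)) /=.
(* The arm [a = 0] is excluded by the range of summation; for [a = i.+1] the only leg is [m - i]. *)
rewrite [RHS]big_ord_recl [X in _ = X + _]big_pred0 ?add0r => [|b]; last by rewrite andbF.
apply: eq_bigr => i _; rewrite (big_pred1 (inord (m - i))) => [|b].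
  rewrite lift0 inordK ?ltnS ?leqW ?leq_subr //.
  have p : is_partition (i.+1 :: nseq (m - i) 1%N).
    rewrite /is_partition /= all_nseq orbT andbT.
    by case: (m - i)%N => //= k; elim: k.
  by rewrite schur_branch // (@jacobi_trudi _ _ _ _ (m - i).+1) //= size_nseq.
rewrite lift0 addSn eqSS andbT /= -val_eqE /= inordK ?ltnS ?leqW ?leq_subr //.
by have := ltn_ord i => hi; apply/eqP/eqP; lia.
Qed.

(** * Generators and spanning families *)

Definition odd_mono : seq nat -> polyfam :=
  monomials (K := fun _ : unit => polyfam) (fun _ r => powersum r.*2.+1) tt.

(** Indexing by arbitrary lists instead of partitions makes closure under products a mere
    concatenation. *)
Lemma doubly_symmetric_mono f : doubly_symmetric f <-> in_span odd_mono f.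
Proof.
rewrite doubly_symmetricP; split; apply: in_span_trans.
  move=> lam; suff -> : powersum_part (val lam) = odd_mono [seq r./2 | r <- parts (val lam)].
    exact: in_span_gen.
  rewrite /odd_mono /monomials big_map /powersum_part big_seq [RHS]big_seq.
  apply: eq_bigr => r hr; congr powersum; have /allP/(_ r hr) := valP lam.
  by move=> ho; rewrite -[LHS]odd_double_half ho.
move=> al; have [|lam hlam] := @intpart_of_seq [seq r.*2.+1 | r <- al].
  by rewrite all_map; apply/allP.
have hodd : odd_partition lam.
  rewrite /odd_partition (perm_all _ hlam) all_map; apply/allP => r _ /=.
  by rewrite odd_double.
suff -> : odd_mono al = powersum_part lam.
  exact: (in_span_gen (fun lam : oddpart => powersum_part (val lam)) (exist _ lam hodd)).
by rewrite /powersum_part (perm_big _ hlam) /= big_map.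
Qed.

Lemma doubly_symmetric_subalgebra : subalgebra doubly_symmetric.
Proof.
split=> [|a f g|f g]; rewrite !doubly_symmetric_mono.
- exact: (@uspan_mono1 unit (fun=> polyfam)).
- by move=> hf; apply: (@uspanD unit (fun=> polyfam)); apply: (@uspanZ unit (fun=> polyfam)).
- exact: (@uspan_monoM unit (fun=> polyfam)).
Qed.

Lemma subalgebra_sum (P : polyfam -> Prop) (I : Type) (s : seq I) (F : I -> polyfam) c :
  subalgebra P -> (forall i, P (F i)) -> P (\sum_(i <- s) c i *: F i).
Proof.
move=> [P1 PL PM] PF; elim: s => [|i s IH]; last by rewrite big_cons; apply: PL.
by have := PL (-1) 1 1 P1 P1; rewrite scaleN1r addNr big_nil.
Qed.

Lemma subalgebra_prod (P : polyfam -> Prop) (s : seq nat) (F : nat -> polyfam) :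
  subalgebra P -> (forall i, i \in s -> P (F i)) -> P (\prod_(i <- s) F i).
Proof.
move=> [P1 PL PM] PF; rewrite big_seq; apply: big_ind => //.
Qed.

Lemma powersum_doubly_symmetric r : odd r -> doubly_symmetric (powersum r).
Proof.
move=> hr; apply/doubly_symmetric_mono.
have -> : r = (r./2).*2.+1 by rewrite -{1}[r]odd_double_half hr.
exact: (@uspan_mono_var unit (fun=> polyfam) (fun _ r => powersum r.*2.+1)).
Qed.

(** A uniform relation, read at [doubled n] for all [n] at once, is a relation between families. *)
Lemma uspan_doubled (I : Type) (v : forall e, I -> ring_at e)
    (F : forall e, ring_at e) (u : I -> polyfam) (f : polyfam) :
  (forall n i, v (doubled n) i = u i n) -> (forall n, F (doubled n) = f n) ->
  uspan v F -> in_span u f.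
Proof.
move=> hv hF [t ht]; exists t => _; apply: polyfamP => n.
by rewrite -hF ht polyfam_sumE; apply: eq_bigr => x _; rewrite hv.
Qed.

Lemma powersum_part_double_schur lam : odd_partition lam ->
  in_span (fun mu : intpart => double_schur mu) (powersum_part lam).
Proof.
move=> hlam; apply: (@in_span_unscale _ _ (2 ^+ size lam)).
  by rewrite expf_eq0 Num.Theory.pnatr_eq0 andbF.
apply: (uspan_doubled S_at_doubled _ (psum_part_S_at lam)) => n.
by rewrite psum_part_doubled hlam.
Qed.

(** At doubled alphabets the power sum products of non-odd partitions vanish, so only the odd ones
    remain. *)
Lemma doubled_doubly_symmetric (F : forall e, ring_at e) (f : polyfam) :
  uspan pmono F -> (forall n, F (doubled n) = f n) -> doubly_symmetric f.
Proof.
move=> /uspan_psum_part hF Ff; apply/doubly_symmetricP.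
pose u (mu : intpart) : polyfam :=
  (if odd_partition mu then 2 ^+ size mu else 0) *: powersum_part mu.
apply: (in_span_trans (u := u)) => [mu|].
  rewrite /u; case: (boolP (odd_partition mu)) => hmu; last first.
    by rewrite scale0r; apply: in_span0.
  apply: in_spanZ.
  exact: (in_span_gen (fun lam : oddpart => powersum_part (val lam)) (exist _ mu hmu)).
by apply: (uspan_doubled _ Ff hF) => n mu; rewrite psum_part_doubled.
Qed.

Lemma double_schur_doubly_symmetric (lam : intpart) :
  doubly_symmetric (double_schur lam).
Proof.
by apply: (doubled_doubly_symmetric (S_at_pmono lam)) => n; rewrite S_at_doubled.
Qed.

Lemma hook_sum_doubly_symmetric m : doubly_symmetric (hook_sum m.+1).
Proof.
apply: (doubled_doubly_symmetric (uspanZ 2^-1 (h_at_pmono m.+1))) => n.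
by rewrite complete_doubled scalerA mulVf ?scale1r.
Qed.

(** The value of $h_r$ at doubled alphabets. The index 0 is separate because [hook_sum 0] is an
    empty sum, whereas $h_0=1$. *)
Definition double_complete r : polyfam := if r is 0 then 1 else 2 *: hook_sum r.

Definition double_complete_mono : seq nat -> polyfam :=
  monomials (K := fun _ : unit => polyfam) (fun=> double_complete) tt.

Lemma powersum_part_hook_sum lam : odd_partition lam ->
  in_span double_complete_mono (powersum_part lam).
Proof.
move=> hlam; apply: (@in_span_unscale _ _ (2 ^+ size lam)).
  by rewrite expf_eq0 Num.Theory.pnatr_eq0 andbF.
have := uspan_trans pmono_hmono (uspan_gen pmono (map predn lam)).
apply: uspan_doubled => [n al|n].
  rewrite /double_complete_mono /monomials polyfam_prodE.
  by apply: eq_bigr => -[|r] _; [exact: complete0 | rewrite complete_doubled].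
transitivity (psum_part (doubled n) lam); last by rewrite psum_part_doubled hlam.
by rewrite psum_part_pmono.
Qed.

Theorem corollary3p7 :
  [/\ generated_by doubly_symmetric
        (fun f => exists n : nat, odd n /\ f = powersum n),
      is_basis_of doubly_symmetric
        (fun lam : {lam : intpart | odd_partition lam} =>
           powersum_part (val lam)),
      spanned_by doubly_symmetric (fun lam : intpart => double_schur lam)
    & generated_by doubly_symmetric
        (fun f => exists n : nat, (1 <= n)%N /\ f = hook_sum n)].
Proof.
split.
- move=> f; split=> [/doubly_symmetric_mono/in_spanP[s [c ->]] P hP hg|]; last first.
    apply; first exact: doubly_symmetric_subalgebra.
    by move=> g [n [hn ->]]; exact: powersum_doubly_symmetric.
  apply: subalgebra_sum => // al; apply: subalgebra_prod => // r _.
  by apply: hg; exists r.*2.+1; rewrite /= odd_double.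
- split=> [f|s c us hs i hi]; first by rewrite doubly_symmetricP in_spanP.
  (* The coefficients are extended by 0 from odd partitions to all, where independence is known. *)
  pose c' (lam : intpart) := if insub lam is Some j then c j else 0.
  have <- : c' (val i) = c i by rewrite /c' valK.
  apply: (powersum_part_indep (s := map val s)); rewrite ?map_inj_uniq ?map_f //.
    exact: val_inj.
  by rewrite big_map -[RHS]hs; apply: eq_bigr => j _; rewrite /c' valK.
- move=> f; rewrite -in_spanP; split=> [/doubly_symmetricP|/in_spanP[s [c ->]]].
    apply: in_span_trans => lam.
    exact/powersum_part_double_schur/(valP lam).
  apply: subalgebra_sum => [|lam]; first exact: doubly_symmetric_subalgebra.
  exact: double_schur_doubly_symmetric.
- move=> f; split=> [/doubly_symmetricP/in_spanP[s [c ->]] P hP hg|]; last first.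
    apply; first exact: doubly_symmetric_subalgebra.
    by move=> g [[|n] [// _ ->]]; exact: hook_sum_doubly_symmetric.
  apply: subalgebra_sum => // lam.
  have /in_spanP[t [a ->]] := powersum_part_hook_sum (valP lam).
  apply: subalgebra_sum => // al; apply: subalgebra_prod => // -[|r] _; first by case: hP.
  have [P1 PL _] := hP; have -> : double_complete r.+1 = 2 *: hook_sum r.+1 + 0 by rewrite addr0.
  apply: (PL); first by apply: hg; exists r.+1.
  by have := PL (-1) 1 1 P1 P1; rewrite scaleN1r addNr.
Qed.
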